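(* Let $DE_{18(10)}$ be the real form of $DE_{18}$ and $\mathfrak{so}(16)\subset DE_{18(10)}$ the subalgebra defined in the context, and let $$\mathfrak{g}^{(com)}=\{x\in DE_{18(10)}:\ [x,y]=0\ \ \forall y\in\mathfrak{so}(16)\}$$ be the commutant of $\mathfrak{so}(16)$. Then $\mathfrak{g}^{(com)}$ contains a Lie subalgebra isomorphic to $DE_{10}$ (the Kac–Moody algebra over $\mathbb{R}$ with the Cartan matrix of $DE_{10}$).
   Context: $DE_{10}$ is the Kac–Moody algebra with simply-laced Dynkin diagram given by the chain $\gamma_{-1}-\gamma_0-\gamma_1-\cdots-\gamma_6$ plus a node $\gamma_7$ joined to $\gamma_1$ and a node $\gamma_8$ joined to $\gamma_5$. $DE_{18}$ is the complex Kac–Moody algebra with simple roots $\beta_{-1},\beta_0,\dots,\beta_{16}$ and simply-laced Dynkin diagram given by the chain $\beta_{-1}-\beta_0-\beta_1-\cdots-\beta_7-\beta_9-\beta_{10}-\cdots-\beta_{14}-\beta_{15}$ plus a node $\beta_8$ joined to $\beta_1$ and a node $\beta_{16}$ joined to $\beta_{14}$. Chevalley generators are $e_i,f_i,h_i$ ($i=-1,\dots,16$), with $[e_i,f_i]=h_i$, $[h_i,e_i]=2e_i$, $[h_i,f_i]=-2f_i$. Real form: let $\omega^*$ be the linear involution of $\mathfrak{h}(DE_{18})^*$ with $\omega^*(\beta_i)=\beta_i$ for $i=-1,\dots,6,8$; $\omega^*(\beta_i)=-\beta_i$ for $i=9,\dots,16$; and $\omega^*(\beta_7)=\beta_7+2\sum_{i=9}^{14}\beta_i+\beta_{15}+\beta_{16}$.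 It preserves the invariant form. Let $\omega$ be an antilinear involutive automorphism of the Lie algebra $DE_{18}$ with $\omega(e_i)=e_i$, $\omega(f_i)=f_i$ for $i=-1,\dots,6,8$; $\omega(e_i)=-f_i$, $\omega(f_i)=-e_i$ for $i=9,\dots,16$; and $\omega(e_7)$, $\omega(f_7)$ nonzero elements of the (one-dimensional) root spaces of $\omega^*(\beta_7)$, $-\omega^*(\beta_7)$ respectively, normalized so that $[\omega(e_7),\omega(f_7)]=\omega(h_7)$. Then $DE_{18(10)}=\{x\in DE_{18}:\omega(x)=x\}$. $\mathfrak{so}(16)\subset DE_{18(10)}$ is the ($\omega$-fixed, compact) real form of the $D_8$ subalgebra of $DE_{18}$ generated by $e_i,f_i,h_i$ for $i=9,\dots,16$. *)

(* Defs.v *)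
(* The real numbers are an arbitrary [R : realType], the complex numbers are
   [R[i]]. *)
From HB Require Import structures.
From mathcomp Require Import all_boot all_order all_algebra.
From mathcomp Require Import boolp classical_sets reals complex.

Set Implicit Arguments.
Unset Strict Implicit.
Unset Printing Implicit Defensive.

Import Order.TTheory GRing.Theory Num.Theory.

Local Open Scope classical_set_scope.
Local Open Scope ring_scope.
Local Open Scope quotient_scope.

HB.mixin Record Lmodule_isLieAlgebra (K : fieldType) (L : Type)
    of GRing.Lmodule K L := {
  lie : L -> L -> L;
  lieDl : forall x y z, lie (x + y) z = lie x z + lie y z;
  lieDr : forall x y z, lie x (y + z) = lie x y + lie x z;
  lieZl : forall a x y, lie (a *: x) y = a *: lie x y;
  lieZr : forall a x y, lie x (a *: y) = a *: lie x y;
  liexx : forall x, lie x x = 0;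
  lie_jacobi : forall x y z,
    lie x (lie y z) + lie y (lie z x) + lie z (lie x y) = 0
}.

#[short(type="lieAlgType")]
HB.structure Definition LieAlgebra (K : fieldType) :=
  {L of Lmodule_isLieAlgebra K L & GRing.Lmodule K L}.

Section LieSubsets.
Variables (K : fieldType) (L : lieAlgType K).
Implicit Types S T : set L.

Definition lie_subalgebra S : Prop :=
  [/\ S 0,
      forall x y, S x -> S y -> S (x + y),
      forall a x, S x -> S (a *: x)
    & forall x y, S x -> S y -> S (lie x y)].

Definition lie_generated T : set L :=
  [set x | forall S, lie_subalgebra S -> T `<=` S -> S x].

Definition lie_commutant S T : set L :=
  [set x | S x /\ forall y, T y -> lie x y = 0].

End LieSubsets.

Definition lie_morphism (K : fieldType) (L M : lieAlgType K) (phi : L -> M) :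
    Prop :=
  [/\ forall x y, phi (x + y) = phi x + phi y,
      forall a x, phi (a *: x) = a *: phi x
    & forall x y, phi (lie x y) = lie (phi x) (phi y)].

(* For a Lie subalgebra [S] of [M]: [L] is isomorphic to [S] when [S] is the
   image of an injective morphism from [L]. *)
Definition lie_isomorphic_to_sub (K : fieldType) (L M : lieAlgType K)
    (S : set M) : Prop :=
  exists phi : L -> M, [/\ lie_morphism phi, injective phi & range phi = S].

(* A complex Lie algebra seen as a real one. *)
Definition realification (R : rcfType) (L : lieAlgType R[i]) : Type := L.

Section Realification.
Variables (R : rcfType) (L : lieAlgType R[i]).
Local Notation Lr := (realification L).

HB.instance Definition _ := GRing.Zmodule.on Lr.

Definition real_scale (a : R) (x : Lr) : Lr := (a%:C)%C *: (x : L).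

Fact real_scaleA a b x : real_scale a (real_scale b x) = real_scale (a * b) x.
Proof. by rewrite /real_scale scalerA rmorphM. Qed.

Fact real_scale1 : left_id 1 real_scale.
Proof. by move=> x; rewrite /real_scale rmorph1 scale1r. Qed.

Fact real_scaleDr : right_distributive real_scale +%R.
Proof. by move=> a x y; rewrite /real_scale scalerDr. Qed.

Fact real_scaleDl x : {morph real_scale^~ x : a b / a + b}.
Proof. by move=> a b; rewrite /real_scale rmorphD scalerDl. Qed.

HB.instance Definition _ := GRing.Zmodule_isLmodule.Build R Lr
  real_scaleA real_scale1 real_scaleDr real_scaleDl.

Definition real_lie (x y : Lr) : Lr := lie (x : L) (y : L).

Fact real_lieZl (a : R) (x y : Lr) : real_lie (a *: x) y = a *: real_lie x y.
Proof. exact: lieZl. Qed.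

Fact real_lieZr (a : R) (x y : Lr) : real_lie x (a *: y) = a *: real_lie x y.
Proof. exact: lieZr. Qed.

HB.instance Definition _ := Lmodule_isLieAlgebra.Build R Lr
  (@lieDl _ L : forall x y z : Lr, real_lie (x + y) z = _)
  (@lieDr _ L : forall x y z : Lr, real_lie x (y + z) = _)
  real_lieZl real_lieZr
  (@liexx _ L : forall x : Lr, real_lie x x = 0)
  (@lie_jacobi _ L).

End Realification.

(* Lie algebras presented by generators and relations: formal Lie expressions
   modulo the smallest congruence that contains the Lie algebra axioms and
   makes the expressions of [rel] equal to zero. *)
Section Presentation.
Variables (K : fieldType) (X : Type).

Inductive lie_expr : Type :=
| Gen of X
| Zero
| Add of lie_expr & lie_expr
| Scale of K & lie_expr
| Bracket of lie_expr & lie_expr.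

HB.instance Definition _ := gen_eqMixin lie_expr.
HB.instance Definition _ := gen_choiceMixin lie_expr.

Variable rel : set lie_expr.

Inductive lie_cong : lie_expr -> lie_expr -> Prop :=
| cong_refl u : lie_cong u u
| cong_sym u v : lie_cong u v -> lie_cong v u
| cong_trans u v w : lie_cong u v -> lie_cong v w -> lie_cong u w
| cong_Add u u' v v' :
    lie_cong u u' -> lie_cong v v' -> lie_cong (Add u v) (Add u' v')
| cong_Scale a u u' : lie_cong u u' -> lie_cong (Scale a u) (Scale a u')
| cong_Bracket u u' v v' :
    lie_cong u u' -> lie_cong v v' -> lie_cong (Bracket u v) (Bracket u' v')
| cong_AddA u v w : lie_cong (Add u (Add v w)) (Add (Add u v) w)
| cong_AddC u v : lie_cong (Add u v) (Add v u)
| cong_Add0 u : lie_cong (Add Zero u) u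
| cong_AddN u : lie_cong (Add (Scale (-1) u) u) Zero
| cong_ScaleA a b u : lie_cong (Scale a (Scale b u)) (Scale (a * b) u)
| cong_Scale1 u : lie_cong (Scale 1 u) u
| cong_ScaleDr a u v :
    lie_cong (Scale a (Add u v)) (Add (Scale a u) (Scale a v))
| cong_ScaleDl a b u :
    lie_cong (Scale (a + b) u) (Add (Scale a u) (Scale b u))
| cong_BracketDl u v w :
    lie_cong (Bracket (Add u v) w) (Add (Bracket u w) (Bracket v w))
| cong_BracketDr u v w :
    lie_cong (Bracket u (Add v w)) (Add (Bracket u v) (Bracket u w))
| cong_BracketZl a u v :
    lie_cong (Bracket (Scale a u) v) (Scale a (Bracket u v))
| cong_BracketZr a u v :
    lie_cong (Bracket u (Scale a v)) (Scale a (Bracket u v))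
| cong_Bracketxx u : lie_cong (Bracket u u) Zero
| cong_jacobi u v w :
    lie_cong (Add (Add (Bracket u (Bracket v w)) (Bracket v (Bracket w u)))
                  (Bracket w (Bracket u v))) Zero
| cong_rel u : rel u -> lie_cong u Zero.

Definition lie_congb (u v : lie_expr) : bool := `[< lie_cong u v >].

Fact lie_congb_equiv : equiv_class_of lie_congb.
Proof.
split.
- by move=> u; apply/asboolP; exact: cong_refl.
- by move=> u v; apply/asboolP/asboolP; exact: cong_sym.
- move=> v u w /asboolP uv /asboolP vw; apply/asboolP.
  exact: cong_trans uv vw.
Qed.

Canonical lie_cong_equiv := EquivRelPack lie_congb_equiv.

Definition presented_lie : Type := {eq_quot lie_cong_equiv}.
Local Notation P := presented_lie.

HB.instance Definition _ := Choice.on P.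

Definition lie_class (u : lie_expr) : P := \pi_{eq_quot lie_cong_equiv} u.
Definition lie_rep (x : P) : lie_expr := repr (x : {eq_quot lie_cong_equiv}).

Lemma lie_classP u v : lie_class u = lie_class v <-> lie_cong u v.
Proof.
split; first by move=> /eqmodP/asboolP.
by move=> uv; apply/eqmodP/asboolP.
Qed.

Lemma lie_repK x : lie_class (lie_rep x) = x.
Proof. exact: reprK. Qed.

Lemma lie_class_repP u : lie_cong (lie_rep (lie_class u)) u.
Proof. by apply/lie_classP; rewrite lie_repK. Qed.

Definition pres_zero : P := lie_class Zero.
Definition pres_add (x y : P) : P := lie_class (Add (lie_rep x) (lie_rep y)).
Definition pres_scale (a : K) (x : P) : P := lie_class (Scale a (lie_rep x)).
Definition pres_opp (x : P) : P := pres_scale (-1) x.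
Definition pres_lie (x y : P) : P :=
  lie_class (Bracket (lie_rep x) (lie_rep y)).

Lemma pres_addE u v :
  pres_add (lie_class u) (lie_class v) = lie_class (Add u v).
Proof. by apply/lie_classP/cong_Add; exact: lie_class_repP. Qed.

Lemma pres_scaleE a u : pres_scale a (lie_class u) = lie_class (Scale a u).
Proof. by apply/lie_classP/cong_Scale/lie_class_repP. Qed.

Lemma pres_lieE u v :
  pres_lie (lie_class u) (lie_class v) = lie_class (Bracket u v).
Proof. by apply/lie_classP/cong_Bracket; exact: lie_class_repP. Qed.

Let presE := (pres_addE, pres_scaleE, pres_lieE).

Fact pres_addA : associative pres_add.
Proof.
move=> x y z; rewrite -[x]lie_repK -[y]lie_repK -[z]lie_repK !presE.
exact/lie_classP/cong_AddA.
Qed.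

Fact pres_addC : commutative pres_add.
Proof.
move=> x y; rewrite -[x]lie_repK -[y]lie_repK !presE.
exact/lie_classP/cong_AddC.
Qed.

Fact pres_add0 : left_id pres_zero pres_add.
Proof.
by move=> x; rewrite -[x]lie_repK !presE; exact/lie_classP/cong_Add0.
Qed.

Fact pres_addN : left_inverse pres_zero pres_opp pres_add.
Proof.
move=> x; rewrite /pres_opp -[x]lie_repK !presE.
exact/lie_classP/cong_AddN.
Qed.

HB.instance Definition _ := GRing.isZmodule.Build P
  pres_addA pres_addC pres_add0 pres_addN.

Lemma lie_classD u v : lie_class (Add u v) = lie_class u + lie_class v.
Proof. exact/esym/pres_addE. Qed.

Fact pres_scaleA a b x : pres_scale a (pres_scale b x) = pres_scale (a * b) x.
Proof.
by rewrite -[x]lie_repK !presE; exact/lie_classP/cong_ScaleA.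
Qed.

Fact pres_scale1 : left_id 1 pres_scale.
Proof.
by move=> x; rewrite -[x]lie_repK !presE; exact/lie_classP/cong_Scale1.
Qed.

Fact pres_scaleDr : right_distributive pres_scale +%R.
Proof.
move=> a x y; rewrite -[x]lie_repK -[y]lie_repK -lie_classD !presE -lie_classD.
exact/lie_classP/cong_ScaleDr.
Qed.

Fact pres_scaleDl x : {morph pres_scale^~ x : a b / a + b}.
Proof.
move=> a b; rewrite -[x]lie_repK !presE -lie_classD.
exact/lie_classP/cong_ScaleDl.
Qed.

HB.instance Definition _ := GRing.Zmodule_isLmodule.Build K P
  pres_scaleA pres_scale1 pres_scaleDr pres_scaleDl.

Lemma lie_classZ a u : lie_class (Scale a u) = a *: lie_class u.
Proof. exact/esym/pres_scaleE. Qed.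

Fact pres_lieDl (x y z : P) : pres_lie (x + y) z = pres_lie x z + pres_lie y z.
Proof.
rewrite -[x]lie_repK -[y]lie_repK -[z]lie_repK -lie_classD !presE -lie_classD.
exact/lie_classP/cong_BracketDl.
Qed.

Fact pres_lieDr (x y z : P) : pres_lie x (y + z) = pres_lie x y + pres_lie x z.
Proof.
rewrite -[x]lie_repK -[y]lie_repK -[z]lie_repK -lie_classD !presE -lie_classD.
exact/lie_classP/cong_BracketDr.
Qed.

Fact pres_lieZl a (x y : P) : pres_lie (a *: x) y = a *: pres_lie x y.
Proof.
rewrite -[x]lie_repK -[y]lie_repK -lie_classZ !presE -lie_classZ.
exact/lie_classP/cong_BracketZl.
Qed.

Fact pres_lieZr a (x y : P) : pres_lie x (a *: y) = a *: pres_lie x y.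
Proof.
rewrite -[x]lie_repK -[y]lie_repK -lie_classZ !presE -lie_classZ.
exact/lie_classP/cong_BracketZr.
Qed.

Fact pres_liexx (x : P) : pres_lie x x = 0.
Proof.
by rewrite -[x]lie_repK !presE; exact/lie_classP/cong_Bracketxx.
Qed.

Fact pres_jacobi (x y z : P) :
  pres_lie x (pres_lie y z) + pres_lie y (pres_lie z x)
    + pres_lie z (pres_lie x y) = 0.
Proof.
rewrite -[x]lie_repK -[y]lie_repK -[z]lie_repK !presE -!lie_classD.
exact/lie_classP/cong_jacobi.
Qed.

HB.instance Definition _ := Lmodule_isLieAlgebra.Build K P
  pres_lieDl pres_lieDr pres_lieZl pres_lieZr pres_liexx pres_jacobi.

End Presentation.

Arguments Zero {K X}.

Inductive chevalley (n : nat) : Type :=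
| CE of 'I_n
| CF of 'I_n
| CH of 'I_n.

Section KacMoody.
Variables (K : fieldType) (n : nat) (A : 'M[int]_n).

Local Notation expr := (lie_expr K (chevalley n)).
Local Notation eqn u v := (Add u (Scale (-1) v)).

(* The Chevalley-Serre relations.  For [i != j] the entry [A i j] of a
   generalized Cartan matrix is nonpositive, so [`|1 - A i j|%N] is the usual
   exponent 1 - A i j. *)
Inductive chevalley_serre : set expr :=
| rel_HH i j : chevalley_serre (Bracket (Gen _ (CH i)) (Gen _ (CH j)))
| rel_HE i j : chevalley_serre
    (eqn (Bracket (Gen _ (CH i)) (Gen _ (CE j)))
         (Scale (A i j)%:~R (Gen _ (CE j))))
| rel_HF i j : chevalley_serre
    (eqn (Bracket (Gen _ (CH i)) (Gen _ (CF j)))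
         (Scale (- (A i j)%:~R) (Gen _ (CF j))))
| rel_EF i : chevalley_serre
    (eqn (Bracket (Gen _ (CE i)) (Gen _ (CF i))) (Gen _ (CH i)))
| rel_EF0 i j : i != j ->
    chevalley_serre (Bracket (Gen _ (CE i)) (Gen _ (CF j)))
| rel_EE i j : i != j -> chevalley_serre
    (iter `|1 - A i j|%N (Bracket (Gen _ (CE i))) (Gen _ (CE j)))
| rel_FF i j : i != j -> chevalley_serre
    (iter `|1 - A i j|%N (Bracket (Gen _ (CF i))) (Gen _ (CF j))).

(* For a symmetrizable generalized Cartan matrix [A] with nonzero determinant,
   this is the Kac-Moody algebra of [A] over [K] (with K of characteristic 0):
   its Cartan subalgebra is spanned by the coroots [km_h i].  (If \det A = 0 it
   is only the derived algebra.) *)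
Definition kac_moody : Type := presented_lie chevalley_serre.

HB.instance Definition _ := LieAlgebra.on kac_moody.

Definition km_e (i : 'I_n) : kac_moody :=
  lie_class chevalley_serre (Gen K (CE i)).
Definition km_f (i : 'I_n) : kac_moody :=
  lie_class chevalley_serre (Gen K (CF i)).
Definition km_h (i : 'I_n) : kac_moody :=
  lie_class chevalley_serre (Gen K (CH i)).

(* When \det A != 0 the simple roots form a basis of the dual of the Cartan
   subalgebra; an element of this dual is given by its row of coordinates in
   this basis.  The value on [km_h i] of the simple root of index j is
   [A i j]. *)
Definition simple_root (i : 'I_n) : 'rV[K]_n := delta_mx 0 i.

Definition weight_eval (alpha : 'rV[K]_n) (i : 'I_n) : K :=
  \sum_j alpha 0 j * (A i j)%:~R.

Definition root_space (alpha : 'rV[K]_n) : set kac_moody :=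
  [set x | forall i, lie (km_h i) x = weight_eval alpha i *: x].

End KacMoody.

(* The nodes of both diagrams are numbered -1, 0, 1, ...; the node numbered k
   has index k + 1. *)
Definition node (n : nat) (i : 'I_n) : int := i%:Z - 1.

Definition cartan_of_edges (n : nat) (E : seq (int * int)) : 'M[int]_n :=
  \matrix_(i, j)
    if i == j then 2
    else if ((node i, node j) \in E) || ((node j, node i) \in E) then -1
    else 0.

Definition edges_DE10 : seq (int * int) :=
  [:: (-1, 0); (0, 1); (1, 2); (2, 3); (3, 4); (4, 5); (5, 6);
      (1, 7); (5, 8)].

Definition edges_DE18 : seq (int * int) :=
  [:: (-1, 0); (0, 1); (1, 2); (2, 3); (3, 4); (4, 5); (5, 6); (6, 7);
      (7, 9); (9, 10); (10, 11); (11, 12); (12, 13); (13, 14); (14, 15);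
      (1, 8); (14, 16)].

Definition cartan_DE10 : 'M[int]_10 := cartan_of_edges 10 edges_DE10.
Definition cartan_DE18 : 'M[int]_18 := cartan_of_edges 18 edges_DE18.

Definition DE10 (K : fieldType) : lieAlgType K := kac_moody K cartan_DE10.
Definition DE18 (K : fieldType) : lieAlgType K := kac_moody K cartan_DE18.

Section RealForm.
Variable R : realType.
Local Notation C := R[i].
Local Notation e := (km_e C cartan_DE18).
Local Notation f := (km_f C cartan_DE18).
Local Notation h := (km_h C cartan_DE18).
Local Notation beta := (simple_root C (n := 18)).

Definition compact_node (i : 'I_18) : bool := 9 <= node i.
Definition split_node (i : 'I_18) : bool := (node i <= 6) || (node i == 8).
Definition node7 : 'I_18 := inord 8.

Definition omega_star_simple (i : 'I_18) : 'rV[C]_18 :=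
  if split_node i then beta i
  else if compact_node i then - beta i
  else beta i + 2 *: (\sum_(j | 9 <= node j <= 14) beta j)
       + \sum_(j | node j == 15) beta j + \sum_(j | node j == 16) beta j.

Definition omega_star (alpha : 'rV[C]_18) : 'rV[C]_18 :=
  \sum_i alpha 0 i *: omega_star_simple i.

Record is_omega (omega : DE18 C -> DE18 C) : Prop := IsOmega {
  omegaD : forall x y, omega (x + y) = omega x + omega y;
  omegaZ : forall a x, omega (a *: x) = (a^*)%C *: omega x;
  omega_lie : forall x y, omega (lie x y) = lie (omega x) (omega y);
  omegaK : forall x, omega (omega x) = x;
  omega_e_split : forall i, split_node i -> omega (e i) = e i;
  omega_f_split : forall i, split_node i -> omega (f i) = f i;
  omega_e_compact : forall i, compact_node i -> omega (e i) = - f i;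
  omega_f_compact : forall i, compact_node i -> omega (f i) = - e i;
  omega_e7_root :
    root_space (A := cartan_DE18) (omega_star (beta node7)) (omega (e node7));
  omega_f7_root :
    root_space (A := cartan_DE18) (- omega_star (beta node7)) (omega (f node7));
  omega_e7_neq0 : omega (e node7) <> 0;
  omega_f7_neq0 : omega (f node7) <> 0;
  omega_h7 : lie (omega (e node7)) (omega (f node7)) = omega (h node7)
}.

(* Real subspaces of DE18 are subsets of its realification. *)
Definition DE18_10 (omega : DE18 C -> DE18 C) : set (realification (DE18 C)) :=
  [set x | omega x = x].

Definition D8 : set (DE18 C) :=
  lie_generated
    [set x | exists2 i, compact_node i & [\/ x = e i, x = f i | x = h i]].

Definition so16 (omega : DE18 C -> DE18 C) : set (realification (DE18 C)) :=
  [set x | D8 x /\ omega x = x].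

Definition g_com (omega : DE18 C -> DE18 C) : set (realification (DE18 C)) :=
  lie_commutant (DE18_10 omega) (so16 omega).

End RealForm.

(* Main.v *)
(* The new simple root gamma_8 of DE10 is delta = beta_6 + beta_7 +
   omega^*(beta_7); its root vectors [[e_6, e_7], omega e_7] and
   [[f_6, f_7], omega f_7] are fixed by omega because [omega e_7, e_7] = 0.  In a
   Kac-Moody algebra with symmetric Cartan matrix no root has norm greater than
   2, and this bound alone gives the Serre relations of DE10 for the chosen
   vectors and shows that they commute with D_8.

   The resulting morphism from DE10 is injective by the Gabber-Kac theorem.
   The bracket of opposite root spaces lies on a line of the Cartan subalgebra,
   which yields the invariant form without a separate construction.  A root
   vector x of minimal height N in the radical of the form is killed by all f_i,
   so by sl2-theory its root mu satisfies (mu, mu) <= 0.  The sum of the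
   operators [u, [u', .]] over dual bases (u), (u') of the root spaces of height
   less than N acts on the root space of mu by the scalar 2 N - (mu, mu), which
   is positive, but it kills x; hence x = 0. *)
From HB Require Import structures.
Require Import Defs.
From mathcomp Require Import all_boot all_order all_algebra.
From mathcomp Require Import boolp classical_sets reals complex.
From mathcomp Require Import zify ring.

Set Implicit Arguments.
Unset Strict Implicit.
Unset Printing Implicit Defensive.

Import Order.TTheory GRing.Theory Num.Theory.

Local Open Scope ring_scope.

(** * Lie algebras by generators and relations *)

(** Why [delta]: the vector $\beta_7+\omega^*\beta_7$ is $\omega^*$-invariant and orthogonal to
    $D_8$, but has norm 4, so it is no root. It pairs to $-2$ with $\beta_6$; adding $\beta_6$
    lowers the norm to 2, makes the product with $\beta_6$ zero and leaves $-1$ with $\beta_5$,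
    which is the second fork of the $DE_{10}$ diagram.

    The obstacle is that both algebras are bare presentations: nothing guarantees at the outset that
    a generator survives, that coroots are independent or that a form exists. Spanning statements
    come from rewriting brackets; independence comes from weights, which $\det A\neq 0$ separates,
    and from the hypothesis that every $e_i$ is nonzero. For $DE_{18}$ this hypothesis follows from
    $\omega(e_7)\neq 0$, spread along the connected diagram; for $DE_{10}$ it follows from the
    nonzero images of the $e_i$.

    The scalar $2N$ is $(2\rho,\mu)$: all simple roots have norm 2, so $(\rho,\alpha_i)=1$ and
    $(\rho,\mu)$ is the height. *)

Section LieTheory.
Variables (K : fieldType) (L : lieAlgType K).
Implicit Types x y z : L.

Lemma lie_is_linear x : linear (lie x).
Proof. by move=> a y z; rewrite lieDr lieZr. Qed.

HB.instance Definition _ x := GRing.isLinear.Build K L L *:%R (lie x)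
  (lie_is_linear x).

Lemma lieC x y : lie y x = - lie x y.
Proof.
apply/eqP; rewrite -addr_eq0 addrC.
by have := liexx (x + y); rewrite lieDl !lieDr !liexx add0r addr0 => ->.
Qed.

Lemma lie0r x : lie x 0 = 0. Proof. exact: raddf0. Qed.
Lemma lie0l x : lie 0 x = 0. Proof. by rewrite lieC lie0r oppr0. Qed.
Lemma lieNr x y : lie x (- y) = - lie x y. Proof. exact: raddfN. Qed.
Lemma lieNl x y : lie (- x) y = - lie x y.
Proof. by rewrite lieC lieNr -lieC. Qed.
Lemma lie_sumr I (r : seq I) P (F : I -> L) x :
  lie x (\sum_(i <- r | P i) F i) = \sum_(i <- r | P i) lie x (F i).
Proof. exact: raddf_sum. Qed.

Lemma lie_suml I (r : seq I) P (F : I -> L) x :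
  lie (\sum_(i <- r | P i) F i) x = \sum_(i <- r | P i) lie (F i) x.
Proof.
by rewrite lieC lie_sumr -sumrN; apply: eq_bigr => i _; rewrite -lieC.
Qed.

Lemma lie_derr x y z : lie x (lie y z) = lie (lie x y) z + lie y (lie x z).
Proof.
have /eqP := lie_jacobi x y z.
rewrite (lieC x z) lieNr (lieC (lie x y) z) => /eqP H.
by apply/eqP; rewrite -subr_eq0 opprD addrA addrAC H.
Qed.

Lemma lie_derl x y z : lie (lie x y) z = lie x (lie y z) - lie y (lie x z).
Proof. by rewrite lie_derr addrK. Qed.

Lemma iter_lie0 k x : iter k (lie x) 0 = 0.
Proof. by elim: k => //= k ->; rewrite lie0r. Qed.

Lemma iter_lieD k x y z :
  iter k (lie x) (y + z) = iter k (lie x) y + iter k (lie x) z.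
Proof. by elim: k => //= k ->; rewrite lieDr. Qed.

Lemma iter_lieZ k a x y : iter k (lie x) (a *: y) = a *: iter k (lie x) y.
Proof. by elim: k => //= k ->; rewrite lieZr. Qed.

Lemma iter_lieN k x y : iter k (lie (- x)) (- y) = (-1) ^+ k.+1 *: iter k (lie
  x) y.
Proof.
elim: k => [|k IH] /=; first by rewrite expr1 scaleN1r.
by rewrite IH lieZr lieNl [in RHS]exprS mulN1r scalerN scaleNr.
Qed.

Lemma iter_lie_eq0W k m x y :
  (k <= m)%N -> iter k (lie x) y = 0 -> iter m (lie x) y = 0.
Proof. by move=> km y0; rewrite -(subnK km) iterD y0 iter_lie0. Qed.

(** By the Leibniz rule each term of $(\mathrm{ad}\,x)^{k+m}[y,z]$ applies [lie x] at least k times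
    to y or at least m times to z. Hence the vectors killed by some power of $\mathrm{ad}\,x$ form a
    subalgebra. *)
Lemma iter_lie_lie_eq0 k m x y z :
  iter k (lie x) y = 0 -> iter m (lie x) z = 0 ->
  iter (k + m) (lie x) (lie y z) = 0.
Proof.
elim: k m y z => [|k IHk] m y z; first by move=> /= -> _;
  rewrite lie0l iter_lie0.
elim: m z => [|m IHm] z y0 z0; first by rewrite [z]z0 lie0r iter_lie0.
rewrite addSn iterSr lie_derr iter_lieD.
rewrite (IHk m.+1) -?iterSr // addnS -addSn.
by rewrite IHm -?iterSr // addr0.
Qed.

Inductive lspan (S : set L) : set L :=
| lspan0 : lspan S 0
| lspanZD a x y : S x -> lspan S y -> lspan S (a *: x + y).

Lemma lspan_sub (S : set L) x : S x -> lspan S x.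
Proof.
by move=> Sx; rewrite -[x]scale1r -[_ *: _]addr0; apply: lspanZD => //;
  exact: lspan0.
Qed.

Lemma lspanD (S : set L) x y : lspan S x -> lspan S y -> lspan S (x + y).
Proof.
elim=> [|a u v Su _ IH] Sy; first by rewrite add0r.
by rewrite -addrA; apply: lspanZD => //; exact: IH.
Qed.

Lemma lspanZ (S : set L) a x : lspan S x -> lspan S (a *: x).
Proof.
elim=> [|b u v Su _ IH]; first by rewrite scaler0; exact: lspan0.
by rewrite scalerDr scalerA; apply: lspanZD.
Qed.

Lemma lspanN (S : set L) x : lspan S x -> lspan S (- x).
Proof. by rewrite -scaleN1r; exact: lspanZ. Qed.

Lemma lspan_ind_linear (S : set L) (T : set L) :
  T 0 -> (forall x y, T x -> T y -> T (x + y)) ->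
  (forall a x, T x -> T (a *: x)) -> (forall x, S x -> T x) ->
  forall x, lspan S x -> T x.
Proof. by move=> T0 TD TZ ST x; elim=> // a u v Su _ Tv; apply/TD/Tv/TZ/ST. Qed.

End LieTheory.

Section Lift.
Variables (K : fieldType) (X : Type) (L : lieAlgType K) (g : X -> L).

Fixpoint lie_eval (u : lie_expr K X) : L :=
  match u with
  | Gen x => g x
  | Zero => 0
  | Add u v => lie_eval u + lie_eval v
  | Scale a u => a *: lie_eval u
  | Bracket u v => lie (lie_eval u) (lie_eval v)
  end.

Lemma lie_eval_iter k u v :
  lie_eval (iter k (Bracket u) v) = iter k (lie (lie_eval u)) (lie_eval v).
Proof. by elim: k => //= k ->. Qed.

Variable rel : set (lie_expr K X).
Hypothesis rel0 : forall u, rel u -> lie_eval u = 0.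

Lemma lie_eval_cong u v : lie_cong rel u v -> lie_eval u = lie_eval v.
Proof.
elim=> //= *; try congruence; try exact: rel0.
all: by rewrite ?(addrA, add0r, addNr, scaleN1r, scalerA, scale1r, scalerDr,
  scalerDl, lieDl, lieDr, lieZl, lieZr, liexx, lie_jacobi) // addrC.
Qed.

Definition pres_lift (x : presented_lie rel) : L := lie_eval (lie_rep x).

Lemma pres_liftE u : pres_lift (lie_class rel u) = lie_eval u.
Proof. exact/lie_eval_cong/lie_class_repP. Qed.

End Lift.

Arguments pres_lift {K X L} g {rel} x.

Section PresentedTheory.
Variables (K : fieldType) (X : Type) (rel : set (lie_expr K X)).
Local Notation P := (presented_lie rel).

Lemma lie_class_lie u v :
  lie_class rel (Bracket u v) = lie (lie_class rel u : P) (lie_class rel v).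
Proof. exact/esym/pres_lieE. Qed.

Lemma lie_class_rel u : rel u -> lie_class rel u = 0 :> P.
Proof. by move=> ru; apply/lie_classP/cong_rel. Qed.

Lemma lie_class_iter k u v : lie_class rel (iter k (Bracket u) v) =
  iter k (lie (lie_class rel u : P)) (lie_class rel v).
Proof. by elim: k => //= k IH; rewrite lie_class_lie IH. Qed.

Lemma presented_ind (S : set P) :
  lie_subalgebra S -> (forall x, S (lie_class rel (Gen K x))) -> forall x, S x.
Proof.
move=> [S0 SD SZ SL] Sg x; rewrite -[x]lie_repK.
elim: (lie_rep x) => [y||u Su v Sv|a u Su|u Su v Sv] //.
- by rewrite lie_classD; exact: SD.
- by rewrite lie_classZ; exact: SZ.
- by rewrite lie_class_lie; exact: SL.
Qed.

Lemma pres_lift_morphism (L : lieAlgType K) (g : X -> L)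
    (rel0 : forall u, rel u -> lie_eval g u = 0) :
  lie_morphism (pres_lift g : P -> L).
Proof.
split=> [x y|a x|x y].
- by rewrite -[x]lie_repK -[y]lie_repK -lie_classD !(pres_liftE rel0).
- by rewrite -[x]lie_repK -lie_classZ !(pres_liftE rel0).
- by rewrite -[x]lie_repK -[y]lie_repK -lie_class_lie !(pres_liftE rel0).
Qed.

End PresentedTheory.

(** * Weight spaces *)

Section UndupSums.
Variables (V : nmodType) (T : eqType).
Implicit Types (b c : T) (s : seq T).

(** With [big_undup_tail], this adds a component of weight c to a decomposition indexed by s,
    whether or not c already occurs in s. *)
Lemma big_undup_single c s (x : V) :
  \sum_(b <- undup (c :: s)) (if b == c then x else 0) = x.
Proof.
rewrite (bigD1_seq c) ?undup_uniq ?mem_undup ?mem_head // eqxx.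
by rewrite big1 /= ?addr0 // => b /negPf ->.
Qed.

Lemma big_undup_tail c s (X : T -> V) : uniq s ->
  \sum_(b <- undup (c :: s)) (if b \in s then X b else 0) = \sum_(b <- s) X b.
Proof.
move=> us /=; case: ifP => cs; rewrite ?big_cons ?cs ?add0r undup_id //.
  by rewrite big_seq [RHS]big_seq; apply: eq_bigr => b ->.
by rewrite big_seq [RHS]big_seq; apply: eq_bigr => b ->.
Qed.

End UndupSums.

Section RootLattice.
Variables (n : nat) (A : 'M[int]_n).
Implicit Types (b c d : 'rV[int]_n) (i j : 'I_n) (w : seq 'I_n).

Definition bil b c : int := (b *m A *m c^T) 0 0.
Definition alpha i : 'rV[int]_n := delta_mx 0 i.
(** Sums of simple roots are represented by words: positivity of a weight is the existence of a
    word, and induction on the height is induction on the size of a word. *)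
Definition content w : 'rV[int]_n := \sum_(i <- w) alpha i.

Lemma bilDl b c d : bil (b + c) d = bil b d + bil c d.
Proof. by rewrite /bil !mulmxDl mxE. Qed.
Lemma bilDr b c d : bil d (b + c) = bil d b + bil d c.
Proof. by rewrite /bil linearD mulmxDr mxE. Qed.
Lemma bilNl b d : bil (- b) d = - bil b d.
Proof. by rewrite /bil !mulNmx mxE. Qed.
Lemma bilNr b d : bil d (- b) = - bil d b.
Proof. by rewrite /bil linearN mulmxN mxE. Qed.
Lemma bil0l d : bil 0 d = 0.
Proof. by rewrite /bil !mul0mx mxE. Qed.
Lemma bil0r d : bil d 0 = 0.
Proof. by rewrite /bil trmx0 mulmx0 mxE. Qed.
Lemma bilMnl b d k : bil (b *+ k) d = bil b d *+ k.
Proof. by elim: k => [|k IH]; rewrite ?mulr0n ?bil0l // !mulrS bilDl IH. Qed.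
Lemma bilMnr b d k : bil d (b *+ k) = bil d b *+ k.
Proof. by elim: k => [|k IH]; rewrite ?mulr0n ?bil0r // !mulrS bilDr IH. Qed.

Lemma bil_alphar b j : bil b (alpha j) = (b *m A) 0 j.
Proof.
rewrite /bil /alpha trmx_delta mxE (bigD1 j) //= [delta_mx _ _ _ _]mxE !eqxx.
rewrite mulr1 big1 ?addr0 // => i /negPf ij.
by rewrite [delta_mx _ _ _ _]mxE ij mulr0.
Qed.

Lemma bil_alpha i j : bil (alpha i) (alpha j) = A i j.
Proof. by rewrite bil_alphar /alpha -rowE mxE. Qed.

Lemma bil_sumr b c : bil b c = \sum_i c 0 i * bil b (alpha i).
Proof.
by rewrite /bil mxE; apply: eq_bigr => i _; rewrite -bil_alphar mxE mulrC.
Qed.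

Lemma content_cons i w : content (i :: w) = alpha i + content w.
Proof. exact: big_cons. Qed.

Lemma contentE w j : content w 0 j = count_mem j w.
Proof.
elim: w => [|i w IH]; first by rewrite /content big_nil mxE.
by rewrite content_cons !mxE IH eqxx /= eq_sym; lia.
Qed.

Lemma alpha_inj : injective alpha.
Proof.
move=> i j /rowP /(_ j); rewrite !mxE !eqxx /=.
by case: (eqVneq j i) => [->|] //.
Qed.

Definition height b : int := \sum_i b 0 i.

Lemma heightD b c : height (b + c) = height b + height c.
Proof. by rewrite /height -big_split; apply: eq_bigr => i _; rewrite mxE. Qed.
Lemma heightN b : height (- b) = - height b.
Proof. by rewrite /height -sumrN; apply: eq_bigr => i _; rewrite mxE. Qed.
Lemma height0 : height 0 = 0.
Proof. by rewrite /height big1 // => i _; rewrite mxE. Qed.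
Lemma height_alpha i : height (alpha i) = 1.
Proof.
rewrite /height (bigD1 i) //= mxE !eqxx big1 ?addr0 // => j /negPf ji.
by rewrite mxE ji andbF.
Qed.

Lemma height_content w : height (content w) = size w.
Proof.
elim: w => [|i w IH]; first by rewrite /content big_nil height0.
by rewrite content_cons heightD IH height_alpha /=; lia.
Qed.

Lemma content_eq0 w : content w = 0 -> w = [::].
Proof. by move/(congr1 height); rewrite height_content height0; case: w. Qed.

Lemma content_opp w w' : content w = - content w' -> w = [::] /\ w' = [::].
Proof.
move/(congr1 height); rewrite heightN !height_content.
by case: w; case: w' => //= *; lia.
Qed.

Lemma content_alpha w i : content w = alpha i -> w = [:: i].
Proof.
move=> wi; have := congr1 height wi; rewrite height_content height_alpha.
case: w wi => [|j [|]] //.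
by rewrite /content big_seq1 => /alpha_inj ->.
Qed.

Lemma content_alphaMn w i k : content w = alpha i *+ k -> w = nseq k i.
Proof.
move=> wi; have sw : size w = k.
  have := congr1 height wi; rewrite height_content.
  have -> : height (alpha i *+ k) = k by
    elim: k {wi} => [|k IH]; rewrite ?mulr0n ?height0 // mulrS heightD IH
      height_alpha; lia.
  by case.
rewrite -sw; apply/all_pred1P/allP => j jw /=; apply/negP => ji.
have /rowP /(_ j) := wi; rewrite contentE -scaler_nat !mxE eqxx.
by rewrite (negPf (introN idP ji)) /= mulr0 => -[/eqP];
  rewrite -leqn0 leqNgt -has_count has_pred1 jw.
Qed.

Hypothesis symA : forall i j, A i j = A j i.
Hypothesis detA : \det A != 0.

Lemma bilC b c : bil b c = bil c b.
Proof.
have AT : A^T = A by apply/matrixP => i j; rewrite mxE.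
rewrite /bil; have -> : b *m A *m c^T = (c *m A *m b^T)^T.
  by rewrite !trmx_mul trmxK AT mulmxA.
by rewrite mxE.
Qed.

(** Multiplying $bA=0$ by the adjugate gives $\det(A)\,b=0$ over the integers. Consequently distinct
    weights are separated by some coroot. *)
Lemma bil_inj b : (forall i, bil b (alpha i) = 0) -> b = 0.
Proof.
move=> b0; have: b *m A *m \adj A = 0.
  rewrite (_ : b *m A = 0) ?mul0mx //.
  by apply/rowP => i; rewrite -bil_alphar b0 mxE.
rewrite -mulmxA mul_mx_adj mul_mx_scalar => /rowP d0; apply/rowP => i.
by have /eqP := d0 i; rewrite !mxE mulf_eq0 (negPf detA) => /eqP.
Qed.

Lemma bil_sub_inj b c : (forall i, bil b (alpha i) = bil c (alpha i)) -> b = c.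
Proof.
move=> bc; apply/eqP; rewrite -subr_eq0; apply/eqP/bil_inj => i.
by rewrite bilDl bilNl bc subrr.
Qed.

End RootLattice.

Section KacMoodyTheory.
Variables (K : numFieldType) (n : nat) (A : 'M[int]_n).
Hypothesis symA : forall i j, A i j = A j i.
Hypothesis detA : \det A != 0.

Local Notation g := (kac_moody K A).
Local Notation e := (km_e K A).
Local Notation f := (km_f K A).
Local Notation h := (km_h K A).
Local Notation al := (@alpha n).
Local Notation bil := (bil A).
Local Notation rel := (@chevalley_serre K n A).
Implicit Types (b c d : 'rV[int]_n) (i j : 'I_n) (w : seq 'I_n) (x y z : g).

Lemma rel_eqn u v : rel (Add u (Scale (-1) v)) ->
  lie_class rel u = lie_class rel v :> g.
Proof.
move=> /lie_class_rel; rewrite lie_classD lie_classZ scaleN1r => /eqP.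
by rewrite subr_eq0 => /eqP.
Qed.

Lemma km_hh i j : lie (h i) (h j) = 0 :> g.
Proof. by rewrite -lie_class_lie; apply: lie_class_rel; exact: rel_HH. Qed.

Lemma km_he i j : lie (h i) (e j) = (A i j)%:~R *: e j :> g.
Proof. by rewrite -lie_class_lie -lie_classZ; apply: rel_eqn;
  exact: rel_HE. Qed.

Lemma km_hf i j : lie (h i) (f j) = - (A i j)%:~R *: f j :> g.
Proof. by rewrite -lie_class_lie -lie_classZ; apply: rel_eqn;
  exact: rel_HF. Qed.

Lemma km_ef i : lie (e i) (f i) = h i :> g.
Proof. by rewrite -lie_class_lie; apply: rel_eqn; exact: rel_EF. Qed.

Lemma km_ef0 i j : i != j -> lie (e i) (f j) = 0 :> g.
Proof. by move=> ij; rewrite -lie_class_lie; apply: lie_class_rel;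
  exact: rel_EF0. Qed.

Lemma km_ee i j : i != j -> iter `|1 - A i j|%N (lie (e i)) (e j) = 0 :> g.
Proof. by move=> ij; rewrite -lie_class_iter; apply: lie_class_rel;
  exact: rel_EE. Qed.

Lemma km_ff i j : i != j -> iter `|1 - A i j|%N (lie (f i)) (f j) = 0 :> g.
Proof. by move=> ij; rewrite -lie_class_iter; apply: lie_class_rel;
  exact: rel_FF. Qed.

Lemma km_ind (S : set g) : lie_subalgebra S -> (forall i, S (e i)) ->
  (forall i, S (f i)) -> forall x, S x.
Proof.
move=> subS Se Sf; apply: presented_ind => // -[i|i|i]; [exact: Se|exact: Sf|].
by rewrite -[lie_class _ _]/(h i) -km_ef; case: subS => _ _ _ SL; apply: SL.
Qed.

(* [eta] is the Chevalley involution. *)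
Definition eta_gen (k : chevalley n) : g :=
  match k with CE i => - f i | CF i => - e i | CH i => - h i end.

Lemma eta_rel u : rel u -> lie_eval eta_gen u = 0.
Proof.
case=> [i j|i j|i j|i|i j ij|i j ij|i j ij] /=; rewrite ?lie_eval_iter /=.
- by rewrite lieNl lieNr opprK km_hh.
- by rewrite lieNl lieNr opprK km_hf scalerN !scaleNr scale1r opprK addNr.
- by rewrite lieNl lieNr opprK km_he scalerN !scaleNr scale1r !opprK subrr.
- by rewrite lieNl lieNr opprK lieC km_ef scalerN scaleN1r opprK addNr.
- by rewrite lieNl lieNr opprK lieC km_ef0 1?eq_sym // oppr0.
- by rewrite iter_lieN km_ff // scaler0.
- by rewrite iter_lieN km_ee // scaler0.
Qed.

Definition eta : g -> g := pres_lift eta_gen.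

Fact eta_is_linear : linear eta.
Proof.
by case: (pres_lift_morphism eta_rel) => D Z _ a x y; rewrite /eta D Z.
Qed.
HB.instance Definition _ := GRing.isLinear.Build K g g *:%R eta eta_is_linear.

Lemma eta_lie x y : eta (lie x y) = lie (eta x) (eta y).
Proof. by case: (pres_lift_morphism eta_rel) => _ _; apply. Qed.
Lemma eta_e i : eta (e i) = - f i. Proof. exact: (pres_liftE eta_rel). Qed.
Lemma eta_f i : eta (f i) = - e i. Proof. exact: (pres_liftE eta_rel). Qed.
Lemma eta_h i : eta (h i) = - h i. Proof. exact: (pres_liftE eta_rel). Qed.

Lemma etaK : involutive eta.
Proof.
apply: (@km_ind (fun x => eta (eta x) = x)) => [|i|i].
- split=> [|x y Hx Hy|a x Hx|x y Hx Hy]; rewrite ?linear0 //.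
  + by rewrite !linearD /= Hx Hy.
  + by rewrite !linearZ /= Hx.
  + by rewrite !eta_lie Hx Hy.
- by rewrite eta_e linearN /= eta_f opprK.
- by rewrite eta_f linearN /= eta_e opprK.
Qed.

Lemma eta_eq0 x : eta x = 0 -> x = 0.
Proof. by move=> x0; rewrite -[x]etaK x0 linear0. Qed.

(** Unlike in [root_space], weights are integral rows, so that signs, heights and norm inequalities
    make sense. *)
Definition wt b : set g :=
  [set x | forall i, lie (h i) x = (bil b (al i))%:~R *: x].

Lemma wt0 b : wt b 0.
Proof. by move=> i; rewrite lie0r scaler0. Qed.
Lemma wtD b x y : wt b x -> wt b y -> wt b (x + y).
Proof. by move=> wx wy i; rewrite lieDr wx wy scalerDr. Qed.
Lemma wtZ b a x : wt b x -> wt b (a *: x).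
Proof. by move=> wx i; rewrite lieZr wx !scalerA mulrC. Qed.
Lemma wtN b x : wt b x -> wt b (- x).
Proof. by rewrite -scaleN1r; exact: wtZ. Qed.
Lemma wtB b x y : wt b x -> wt b y -> wt b (x - y).
Proof. by move=> wx wy; apply: wtD => //; exact: wtN. Qed.
Lemma wt_sum b I (r : seq I) (P : pred I) (F : I -> g) :
  (forall k, P k -> wt b (F k)) -> wt b (\sum_(k <- r | P k) F k).
Proof. by move=> wF; elim/big_rec: _ => [|k x Pk wx];
  [exact: wt0|exact/wtD/wx/wF]. Qed.

Lemma wt_lie b c x y : wt b x -> wt c y -> wt (b + c) (lie x y).
Proof.
move=> wx wy i.
by rewrite lie_derr wx wy lieZl lieZr -scalerDl bilDl intrD.
Qed.

Lemma wt_h i : wt 0 (h i).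
Proof. by move=> j; rewrite km_hh bil0l scale0r. Qed.
Lemma wt_e i : wt (al i) (e i).
Proof. by move=> j; rewrite km_he bil_alpha symA. Qed.
Lemma wt_f i : wt (- al i) (f i).
Proof. by move=> j; rewrite km_hf bilNl bil_alpha symA intrN. Qed.

Lemma wt_eta b x : wt b x -> wt (- b) (eta x).
Proof.
move=> wx i; rewrite -[h i]opprK -eta_h lieNl -eta_lie wx linearZ /=.
by rewrite bilNl intrN scaleNr.
Qed.

Lemma wt_lie_e b i x : wt b x -> wt (al i + b) (lie (e i) x).
Proof. exact/wt_lie/wt_e. Qed.
Lemma wt_lie_f b i x : wt b x -> wt (- al i + b) (lie (f i) x).
Proof. exact/wt_lie/wt_f. Qed.
Lemma wt_iter_lie_f b i x k : wt b x ->
  wt (b - al i *+ k) (iter k (lie (f i)) x).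
Proof.
move=> wx; elim: k => [|k IH] /=; first by rewrite mulr0n subr0.
by rewrite mulrS opprD addrCA; exact: wt_lie_f.
Qed.

(* The element of the Cartan subalgebra that corresponds to [b] under the
   invariant form. *)
Definition nu b : g := \sum_i (b 0 i)%:~R *: h i.

Lemma nuD b c : nu (b + c) = nu b + nu c.
Proof.
by rewrite /nu -big_split; apply: eq_bigr => i _; rewrite mxE intrD scalerDl.
Qed.
Lemma nu_alpha i : nu (al i) = h i.
Proof.
rewrite /nu (bigD1 i) //= mxE !eqxx scale1r big1 ?addr0 // => j /negPf ji.
by rewrite mxE ji andbF scale0r.
Qed.

Lemma lie_nu b c x : wt c x -> lie (nu b) x = (bil b c)%:~R *: x.
Proof.
move=> wx; rewrite /nu lie_suml bilC // bil_sumr rmorph_sum scaler_suml.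
by apply: eq_bigr => i _; rewrite lieZl wx scalerA -intrM.
Qed.

Lemma wt_nu b : wt 0 (nu b).
Proof. by apply: wt_sum => i _; apply: wtZ; exact: wt_h. Qed.

(** Right-normed brackets. The empty word has value 0, so a one-letter word is a separate case and
    [word_cons] asks for a nonempty tail. *)
Fixpoint word (gen : 'I_n -> g) w : g :=
  match w with
  | [::] => 0
  | [:: i] => gen i
  | i :: w' => lie (gen i) (word gen w')
  end.

Lemma word_cons gen i w : w != [::] ->
  word gen (i :: w) = lie (gen i) (word gen w).
Proof. by case: w. Qed.

Lemma wt_word_e w : wt (content w) (word e w).
Proof.
elim: w => [|i [|j w] IH]; first exact: wt0.
- by rewrite /content big_seq1; exact: wt_e.
- by rewrite word_cons // content_cons; exact: wt_lie_e.
Qed.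

Lemma eta_word_e w : exists s : K, eta (word e w) = s *: word f w.
Proof.
elim: w => [|i [|j w] [s IH]]; first by exists 0; rewrite linear0 scaler0.
- by exists (-1); rewrite scaleN1r /= eta_e.
- exists (- s); rewrite [LHS]eta_lie IH eta_e lieNl lieZr.
  by rewrite scaleNr.
Qed.

Lemma eta_word_f w : exists s : K, eta (word f w) = s *: word e w.
Proof.
elim: w => [|i [|j w] [s IH]]; first by exists 0; rewrite linear0 scaler0.
- by exists (-1); rewrite scaleN1r /= eta_f.
- exists (- s); rewrite [LHS]eta_lie IH eta_f lieNl lieZr.
  by rewrite scaleNr.
Qed.

Lemma wt_word_f w : wt (- content w) (word f w).
Proof.
elim: w => [|i [|j w] IH]; first exact: wt0.
- by rewrite /content big_seq1; exact: wt_f.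
- by rewrite word_cons // content_cons opprD; exact: wt_lie_f.
Qed.

Inductive weight_vector : 'rV[int]_n -> g -> Prop :=
| weight_vector_e w : weight_vector (content w) (word e w)
| weight_vector_f w : weight_vector (- content w) (word f w)
| weight_vector_h i : weight_vector 0 (h i).

Lemma weight_vector_wt b x : weight_vector b x -> wt b x.
Proof. by case=> *; [exact: wt_word_e|exact: wt_word_f|exact: wt_h]. Qed.

Definition weight_vectors : set g := [set x | exists b, weight_vector b x].
Local Notation tri := (lspan weight_vectors).

Lemma tri_word_e w : tri (word e w).
Proof. by apply: lspan_sub; exists (content w); exact: weight_vector_e. Qed.
Lemma tri_word_f w : tri (word f w).
Proof. by apply: lspan_sub; exists (- content w); exact: weight_vector_f. Qed.
Lemma tri_h i : tri (h i).
Proof. by apply: lspan_sub; exists 0; exact: weight_vector_h. Qed.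
Lemma tri_e i : tri (e i). Proof. exact: (tri_word_e [:: i]). Qed.
Lemma tri_f i : tri (f i). Proof. exact: (tri_word_f [:: i]). Qed.

Definition lower_vectors : set g :=
  [set x | (exists w, x = word f w) \/ (exists i, x = h i)].

Lemma lower_lie_f i x : lspan lower_vectors x ->
  lspan lower_vectors (lie (f i) x).
Proof.
move: x; apply: lspan_ind_linear => [|x y Hx Hy|a x Hx|x [[w ->]|[j ->]]].
- by rewrite lie0r; exact: lspan0.
- by rewrite lieDr; exact: lspanD.
- by rewrite lieZr; exact: lspanZ.
- case: (eqVneq w [::]) => [->|w0]; first by rewrite lie0r; exact: lspan0.
  by rewrite -word_cons //; apply: lspan_sub; left; exists (i :: w).
- rewrite lieC km_hf -scaleNr; apply: lspanZ; apply: lspan_sub.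
  by left; exists [:: i].
Qed.

(** As a derivation, [e i] meets the first letter in 0 or in a coroot, and the coroot only scales
    the remaining word; so the result stays in $\mathfrak n_-+\mathfrak h$. *)
Lemma lower_lie_e i w : lspan lower_vectors (lie (e i) (word f w)).
Proof.
have lh j : lspan lower_vectors (h j) by apply: lspan_sub; right; exists j.
have lef j : lspan lower_vectors (lie (e i) (f j)).
  case: (eqVneq i j) => [->|ij]; first by rewrite km_ef.
  by rewrite km_ef0 //; exact: lspan0.
elim: w => [|j w IH]; first by rewrite lie0r; exact: lspan0.
case: (eqVneq w [::]) => [->|w0]; first exact: lef.
rewrite word_cons // lie_derr; apply: lspanD; last exact: lower_lie_f.
case: (eqVneq i j) => [->|ij].
  rewrite km_ef wt_word_f; apply: lspanZ; apply: lspan_sub.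
  by left; exists w.
by rewrite km_ef0 // lie0l; exact: lspan0.
Qed.

Lemma tri_lie_e i x : tri x -> tri (lie (e i) x).
Proof.
move: x; apply: lspan_ind_linear => [|x y Hx Hy|a x Hx|x [b [w|w|j]]].
- by rewrite lie0r; exact: lspan0.
- by rewrite lieDr; exact: lspanD.
- by rewrite lieZr; exact: lspanZ.
- case: (eqVneq w [::]) => [->|w0]; first by rewrite lie0r; exact: lspan0.
  by rewrite -word_cons //; exact: tri_word_e.
- elim: (lower_lie_e i w) => [|a u v Lu _ Tv]; first exact: lspan0.
  apply: lspanD => //; apply: lspanZ.
  by case: Lu => [[w' ->]|[j ->]]; [exact: tri_word_f|exact: tri_h].
- by rewrite lieC km_he -scaleNr; apply: lspanZ; exact: tri_e.
Qed.

Lemma tri_eta x : tri x -> tri (eta x).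
Proof.
move: x; apply: lspan_ind_linear => [|x y Hx Hy|a x Hx|x [b [w|w|j]]].
- by rewrite linear0; exact: lspan0.
- by rewrite linearD; exact: lspanD.
- by rewrite linearZ; exact: lspanZ.
- by have [s ->] := eta_word_e w; apply: lspanZ; exact: tri_word_f.
- by have [s ->] := eta_word_f w; apply: lspanZ; exact: tri_word_e.
- by rewrite eta_h; apply: lspanN; exact: tri_h.
Qed.

Lemma tri_lie_f i x : tri x -> tri (lie (f i) x).
Proof.
move=> tx; rewrite -[f i]opprK -eta_e -[x]etaK lieNl -eta_lie.
by apply/lspanN/tri_eta/tri_lie_e/tri_eta.
Qed.

(** By the Jacobi identity the y with $[y,\mathrm{tri}]\subseteq\mathrm{tri}$ form a subalgebra, and
    it contains the generators. This is the spanning half of the triangular decomposition;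
    independence of the weight components comes from [graded_components]. *)
Lemma tri_full x : tri x.
Proof.
have triN y : forall z, tri z -> tri (lie y z).
  apply: (@km_ind (fun y => forall z, tri z -> tri (lie y z))).
  - split=> [z _|u v Hu Hv z Tz|a u Hu z Tz|u v Hu Hv z Tz].
    + by rewrite lie0l; exact: lspan0.
    + by rewrite lieDl; apply: lspanD; [exact: Hu|exact: Hv].
    + by rewrite lieZl; apply/lspanZ/Hu.
    + rewrite lie_derl; apply: lspanD; first exact/Hu/Hv.
      exact/lspanN/Hv/Hu.
  - by move=> i z; exact: tri_lie_e.
  - by move=> i z; exact: tri_lie_f.
apply: km_ind => [|i|i]; [|exact: tri_e|exact: tri_f].
split; [exact: lspan0|exact: lspanD|exact: lspanZ|].
by move=> u v _; exact: triN.
Qed.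

(** A Vandermonde-type argument: a subspace stable under the coroots is graded. It is applied to the
    zero subspace, which gives independence of weight spaces, and to the kernel of a morphism. *)
Lemma graded_components (S : set g) (s : seq 'rV[int]_n) (X : 'rV[int]_n -> g) :
  S 0 -> (forall x y, S x -> S y -> S (x + y)) -> (forall a x,
    S x -> S (a *: x)) ->
  (forall i x, S x -> S (lie (h i) x)) ->
  uniq s -> (forall b, b \in s -> wt b (X b)) -> S (\sum_(b <- s) X b) ->
  forall b, b \in s -> S (X b).
Proof.
move=> S0 SD SZ Sh; elim: s X => [//|c s IH] X /= /andP [cs us] wX.
rewrite big_cons => SX.
have Ss b : b \in s -> S (X b).
  move=> bs; have [i ci] : exists i, bil b (al i) != bil c (al i).
    apply/existsP; apply: contraNT cs => /existsPn bc; rewrite -(_ : b = c) //.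
    by apply: (bil_sub_inj detA) => i; apply/eqP; rewrite -[_ == _]negbK;
      exact: bc.
  (* Subtracting from [lie (h i)] its eigenvalue on [X c] removes [X c] and multiplies [X b] by a
     nonzero integer, so the induction hypothesis applies to the rest. *)
  have := IH (fun b => (bil b (al i) - bil c (al i))%:~R *: X b) us.
  move=> /(_ _ _ b bs) SXb.
  rewrite -[X b](@scalerK _ _ (bil b (al i) - bil c (al i))%:~R); last first.
    by rewrite intr_eq0 subr_eq0.
  apply/SZ/SXb => [d ds|]; first by apply: wtZ; apply: wX; rewrite inE ds orbT.
  have := SD _ _ (Sh i _ SX) (SZ (- (bil c (al i))%:~R) _ SX).
  rewrite lieDr (wX c) ?mem_head // scalerDr scaleNr addrACA subrr add0r.
  rewrite lie_sumr scaler_sumr -big_split /=; congr S;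
    apply: eq_big_seq => d ds.
  by rewrite (wX d) ?inE ?ds ?orbT // -scalerDl intrB.
move=> b; rewrite inE => /predU1P [->|]; last exact: Ss.
have -> : X c = X c + \sum_(d <- s) X d + (-1) *: \sum_(d <- s) X d.
  by rewrite scaleN1r addrK.
apply: (SD) => //; apply: SZ.
by rewrite big_seq; apply: (big_ind S) => // d ds; exact: Ss.
Qed.

Lemma weight_decomposition x : exists (s : seq 'rV[int]_n) (X : 'rV[int]_n ->
  g),
  [/\ uniq s, forall b, lspan (weight_vector b) (X b) & x = \sum_(b <- s) X b].
Proof.
elim: (tri_full x) => [|a u v [c cu] _ [s [X [us HX ->]]]].
  by exists [::], (fun=> 0); split=> // [b|]; [exact: lspan0|rewrite big_nil].
pose Y b := (if b == c then a *: u else 0) + (if b \in s then X b else 0).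
exists (undup (c :: s)), Y; split; first exact: undup_uniq.
  move=> b; apply: lspanD; last by case: ifP => // _; exact: lspan0.
  case: eqP => [->|_]; last exact: lspan0.
  exact/lspanZ/lspan_sub.
by rewrite big_split big_undup_single big_undup_tail.
Qed.

Lemma wt_span b x : wt b x -> lspan (weight_vector b) x.
Proof.
move=> wx; have [s [X [us HX xs]]] := weight_decomposition x.
have wX c : wt c (X c).
  move: (X c) (HX c); apply: lspan_ind_linear;
    [exact: wt0|exact: wtD|exact: wtZ|].
  exact: weight_vector_wt.
(* The relation $-x+\sum_c X_c=0$, with [- x] merged into the component of weight b. Its vanishing
   at b says that x is [X b], or 0 when b is not in s. *)
pose Y c := (if c == b then - x else 0) + (if c \in s then X c else 0).
have Yb : Y b = 0.
  apply: (@graded_components (fun y => y = 0) (undup (b :: s)) Y) => //.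
  - by move=> y z -> ->; rewrite addr0.
  - by move=> a y ->; rewrite scaler0.
  - by move=> i y ->; rewrite lie0r.
  - exact: undup_uniq.
  - move=> c _; apply: wtD; last by case: ifP => // _; exact: wt0.
    by case: eqP => [->|_]; [exact: wtN|exact: wt0].
  - by rewrite big_split big_undup_single big_undup_tail // -xs /= addNr.
  - by rewrite mem_undup mem_head.
move: Yb; rewrite /Y eqxx; case: ifP => _ /eqP.
  by rewrite addrC subr_eq0 => /eqP <-.
by rewrite addr0 oppr_eq0 => /eqP ->; exact: lspan0.
Qed.

(** Spanning vectors are words in the e alone, words in the f alone, or coroots, so mixed signs
    cannot occur. Weight 0 is covered by the empty word. *)
Lemma wt_sign b x : wt b x -> x != 0 ->
  (exists w, b = content w) \/ (exists w, b = - content w).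
Proof.
move=> /wt_span; elim=> [|a u v]; first by rewrite eqxx.
case=> [w|w|i] _ _ _; [by left; exists w|by right; exists w|].
by left; exists [::]; rewrite /content big_nil.
Qed.

Lemma wt_cartan x : wt 0 x -> lspan [set y | exists i, y = h i] x.
Proof.
move=> /wt_span; apply: lspan_ind_linear;
  [exact: lspan0|exact: lspanD|exact: lspanZ|].
move=> y; move E: 0 => b Hy; case: Hy E => [w /esym/content_eq0 ->|w|i _].
- exact: lspan0.
- by move=> /esym/eqP; rewrite oppr_eq0 => /eqP/content_eq0 ->; exact: lspan0.
- by apply: lspan_sub; exists i.
Qed.

Lemma wt_pos w x : w != [::] -> wt (content w) x ->
  lspan [set y | exists2 w', content w' = content w & y = word e w'] x.
Proof.
move=> w0 /wt_span; apply: lspan_ind_linear;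
  [exact: lspan0|exact: lspanD|exact: lspanZ|].
move=> y; move E: (content w) => b Hy; case: Hy E => [w' E|w'|i].
- by apply: lspan_sub; exists w'.
- by move=> /content_opp [w0']; rewrite w0' in w0.
- by move=> /content_eq0 w0'; rewrite w0' in w0.
Qed.

Lemma wt_neg w x : w != [::] -> wt (- content w) x ->
  lspan [set y | exists2 w', content w' = content w & y = word f w'] x.
Proof.
move=> w0 /wt_eta; rewrite opprK -{2}[x]etaK => /(wt_pos w0).
move: (eta x); apply: lspan_ind_linear => [|u v Hu Hv|a u Hu|u [w' cw ->]].
- by rewrite linear0; exact: lspan0.
- by rewrite linearD; exact: lspanD.
- by rewrite linearZ; exact: lspanZ.
- have [s ->] := eta_word_e w'; apply: lspanZ; apply: lspan_sub.
  by exists w'.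
Qed.

Lemma wt_alpha i x : wt (al i) x -> exists a, x = a *: e i.
Proof.
rewrite (_ : al i = content [:: i]); last by rewrite /content big_seq1.
move=> /(wt_pos (w := [:: i]) isT).
apply: (@lspan_ind_linear _ _ _ (fun x => exists a, x = a *: e i)).
- by exists 0; rewrite scale0r.
- by move=> u v [a ->] [b ->]; exists (a + b); rewrite scalerDl.
- by move=> a u [b ->]; exists (a * b); rewrite scalerA.
- move=> u [w]; rewrite /content big_seq1 => /content_alpha -> ->.
  by exists 1; rewrite scale1r.
Qed.

Lemma wt_alphaN i x : wt (- al i) x -> exists a, x = a *: f i.
Proof.
move=> /wt_eta; rewrite opprK => /wt_alpha [a xa]; exists (- a).
by rewrite -[x]etaK xa linearZ /= eta_e scaleNr scalerN.
Qed.

(** The only word of this content is constant, and its innermost bracket is $[e_i,e_i]=0$. *)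
Lemma wt_alphaMn i k x : (1 < k)%N -> wt (al i *+ k) x -> x = 0.
Proof.
move=> k1; have -> : al i *+ k = content (nseq k i).
  by rewrite /content big_nseq; elim: k {k1} => //= k IH; rewrite mulrS IH.
have kn0 : nseq k i != [::] by case: k k1.
move=> /(wt_pos kn0); apply: (@lspan_ind_linear _ _ _ (fun x => x = 0)) => //.
- by move=> u v -> ->; rewrite addr0.
- by move=> a u ->; rewrite scaler0.
move=> u [w]; have -> : content (nseq k i) = al i *+ k.
  by rewrite /content big_nseq; elim: k {k1 kn0} => //= k IH; rewrite mulrS IH.
move=> /content_alphaMn -> ->.
case: k k1 kn0 => [|[|k]] // _ _; elim: k => [|k IH]; first exact: liexx.
by rewrite -[nseq k.+3 i]/(i :: nseq k.+2 i) word_cons // IH lie0r.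
Qed.

(** Splitting off the first letter of each spanning word; this drives the later inductions on the
    height. *)
Lemma wt_step w x : (1 < size w)%N -> wt (content w) x ->
  lspan [set y | exists i w' z, [/\ content w = al i + content w',
    wt (content w') z
     & y = lie (e i) z]] x.
Proof.
move=> w1 wx; have w0 : w != [::] by case: w w1 {wx}.
move: x {wx} (wt_pos w0 wx); apply: lspan_ind_linear;
  [exact: lspan0|exact: lspanD|exact: lspanZ|].
move=> y [w' cw ->]; have := congr1 (@height n) cw;
  rewrite !height_content => -[sw].
case: w' cw sw => [|i w'] cw /= sw; first by rewrite -sw in w1.
have w'0 : w' != [::] by case: w' sw {cw} => //= sw; rewrite -sw in w1.
apply: lspan_sub; exists i, w', (word e w'); split;
  [|exact: wt_word_e|exact: word_cons].
by rewrite -cw content_cons.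
Qed.

End KacMoodyTheory.

(** * Norms of roots *)

Section RootNorms.
Variables (K : numFieldType) (n : nat) (A : 'M[int]_n).
Hypothesis symA : forall i j, A i j = A j i.
Hypothesis diagA : forall i, A i i = 2.
Hypothesis detA : \det A != 0.

Local Notation g := (kac_moody K A).
Local Notation e := (km_e K A).
Local Notation f := (km_f K A).
Local Notation h := (km_h K A).
Local Notation al := (@alpha n).
Local Notation bil := (bil A).
Local Notation wt := (@wt K n A).
Local Notation nu := (@nu K n A).
Implicit Types (b : 'rV[int]_n) (i j : 'I_n) (w : seq 'I_n) (x y z : g).

Lemma content_cat w w' : content (w ++ w') = content w + content w'.
Proof. by rewrite /content big_cat. Qed.

Lemma content1 i : content [:: i] = al i.
Proof. by rewrite /content big_seq1. Qed.

Lemma content_nseq k i : content (nseq k i) = al i *+ k.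
Proof. by elim: k => [|k IH];
  rewrite ?mulrS -?IH -?content_cons // /content big_nil. Qed.

(** The Serre relations settle the [e j], three steps kill [f i], and the Leibniz rule extends
    nilpotency to brackets. *)
Lemma e_locally_nilpotent i x : exists k, iter k (lie (e i)) x = 0.
Proof.
apply: (@km_ind _ _ _ (fun x => exists k, iter k (lie (e i)) x = 0)) => [|j|j].
- split=> [|y z [k yk] [m zm]|a y [k yk]|y z [k yk] [m zm]].
  + by exists 0.
  + exists (maxn k m); rewrite iter_lieD (iter_lie_eq0W _ yk) ?leq_maxl //.
    by rewrite (iter_lie_eq0W _ zm) ?leq_maxr // addr0.
  + by exists k; rewrite iter_lieZ yk scaler0.
  + by exists (k + m)%N; exact: iter_lie_lie_eq0.
- case: (eqVneq i j) => [->|ij]; first by exists 1; exact: liexx.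
  by exists `|1 - A i j|%N; exact: km_ee.
- case: (eqVneq i j) => [->|ij]; last by exists 1; exact: km_ef0.
  by exists 3; rewrite /= km_ef (lieC (h j)) km_he lieNr lieZr liexx scaler0
    oppr0.
Qed.

Lemma lie_e_iter_f b i x k : wt b x ->
  lie (e i) (iter k.+1 (lie (f i)) x) =
  iter k.+1 (lie (f i)) (lie (e i) x)
  + (k.+1%:R * ((bil b (al i))%:~R - k%:R)) *: iter k (lie (f i)) x.
Proof.
move=> wx; elim: k => [|k IH].
  by rewrite /= lie_derr km_ef wx mul1r subr0 addrC.
rewrite iterS lie_derr km_ef IH lieDr -iterS lieZr -iterS.
have -> := wt_iter_lie_f symA i k.+1 wx i.
rewrite addrCA -scalerDl; congr (_ + _ *: _).
rewrite bilDl bilNl bilMnl bil_alpha diagA -[2 *+ _]mulr_natr.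
by rewrite intrD intrN intrM -!natr1; ring.
Qed.

Lemma sl2_injective b i x k : wt b x -> k%:Z <= bil b (al i) ->
  iter k (lie (f i)) x = 0 -> x = 0.
Proof.
have [N] := e_locally_nilpotent i x.
(* [e_i x] satisfies the same hypotheses, with weight + 2 and k + 1 *)
elim: N b x k => [//|N IH] b x k ex wx kb fx.
have ex0 : lie (e i) x = 0.
  apply: (IH (al i + b) _ k.+1); first by rewrite -iterSr.
  - exact: wt_lie_e.
  - by rewrite bilDl bil_alpha diagA; lia.
  - have := lie_e_iter_f i k wx; rewrite /= fx !lie0r scaler0 addr0.
    by move=> <-.
elim: k kb fx => [|k IHk] kb fx //.
apply: IHk; first lia.
(* Since [e i] kills x, the formula reads $0=(k+1)((b,\alpha_i)-k)f_i^kx$ with a positive factor, so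
   k can be lowered. *)
have := lie_e_iter_f i k wx; rewrite fx lie0r ex0 iter_lie0 add0r => /esym/eqP.
rewrite scaler_eq0 mulf_eq0 pnatr_eq0 /= => /orP [|/eqP //].
by rewrite subr_eq0 -[k%:R]/(k%:Z%:~R) eqr_int => /eqP; lia.
Qed.

Lemma wt_norm_pos w x : wt (content w) x -> 2 < bil (content w) (content w) ->
  x = 0.
Proof.
(* Reflections lower the height until the root is simple (norm 2) or
   antidominant (norm at most 0). *)
elim: {w}(size w).+1 {-2}w (ltnSn (size w)) x => [//|N IH] w wN x wx n2.
apply/eqP; apply/negPn/negP => x0.
have [i ib] : exists i, 0 < bil (content w) (al i).
  have [/existsP //|/existsPn nb] := boolP [exists i,
    0 < bil (content w) (al i)].
  have : bil (content w) (content w) <= 0.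
    rewrite bil_sumr; apply: sumr_le0 => i _; apply: mulr_ge0_le0.
      by rewrite contentE.
    by rewrite leNgt nb.
  by lia.
pose m := `|bil (content w) (al i)|%N.
have mE : bil (content w) (al i) = m by rewrite /m; lia.
have wy := wt_iter_lie_f symA i m wx.
have y0 : iter m (lie (f i)) x != 0.
  by apply: contra_neq x0; apply: sl2_injective wx _; rewrite mE.
have ny : bil (content w - al i *+ m) (content w - al i *+ m) = bil (content w)
  (content w).
  rewrite !bilDl !bilDr !bilNl !bilNr !bilMnl !bilMnr bil_alpha diagA.
  by rewrite (bilC symA (al i)) mE !pmulrn !mulrzz; ring.
case: (wt_sign symA detA wy y0) => -[w' cw].
  (* The reflected weight is positive, of the same norm and of smaller height. *)
  case/eqP: y0; apply: (IH w'); rewrite -?cw ?ny //.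
  have : content w = content (nseq m i ++ w').
    by rewrite content_cat content_nseq -cw addrC subrK.
  move=> /(congr1 (@height n)); rewrite !height_content size_cat size_nseq.
  by move: ib wN; rewrite mE; lia.
(* The reflected weight is $-$[content w'], which forces w to be a constant word; its weight is then
   0, $\alpha_i$ of norm 2, or a multiple of $\alpha_i$ without root vectors. *)
have /content_alphaMn : content (w ++ w') = al i *+ m.
  by rewrite content_cat -[content w'](opprK) -cw opprB addrC subrK.
move=> ww; have: all (pred1 i) (w ++ w') by rewrite ww all_nseq /= eqxx orbT.
rewrite all_cat => /andP [/all_pred1P wE _].
move: wx n2; rewrite wE content_nseq bilMnl bilMnr bil_alpha diagA => wx.
case: (ltnP 1 (size w)) => [w1|].
  by case/eqP: x0; exact: (wt_alphaMn symA detA w1 wx).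
by case: (size w) => [|[|]].
Qed.

Lemma wt_norm b x : wt b x -> 2 < bil b b -> x = 0.
Proof.
move=> wx; case: (eqVneq x 0) => // x0;
  case: (wt_sign symA detA wx x0) => -[w bw].
  by rewrite bw in wx *; exact: wt_norm_pos.
move: wx; rewrite bw bilNl bilNr opprK => /wt_eta; rewrite opprK => wx n2.
exact/eta_eq0/(wt_norm_pos wx).
Qed.

End RootNorms.

(** * The invariant form *)

Section InvariantForm.
Variables (K : numFieldType) (n : nat) (A : 'M[int]_n).
Hypothesis symA : forall i j, A i j = A j i.
Hypothesis diagA : forall i, A i i = 2.
Hypothesis detA : \det A != 0.

Local Notation g := (kac_moody K A).
Local Notation e := (km_e K A).
Local Notation f := (km_f K A).
Local Notation h := (km_h K A).
Local Notation al := (@alpha n).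
Local Notation bil := (bil A).
Local Notation wt := (@wt K n A).
Local Notation nu := (@nu K n A).
Implicit Types (b : 'rV[int]_n) (i j : 'I_n) (w : seq 'I_n) (x y z : g).

Lemma cartan_row_eq0 (c : 'rV[K]_n) :
  (forall j, \sum_i c 0 i * (A i j)%:~R = 0) -> c = 0.
Proof.
move=> c0; have cA : c *m map_mx intr A = 0.
  by apply/rowP => j; rewrite !mxE -[RHS](c0 j); apply: eq_bigr => i _;
    rewrite mxE.
have uA : map_mx intr A \in @unitmx K n.
  by rewrite unitmxE det_map_mx unitfE intr_eq0.
by rewrite -[c](mulmxK uA) cA mul0mx.
Qed.

Lemma lie_cartan_e (c : 'rV[K]_n) j :
  lie (\sum_i c 0 i *: h i) (e j) = (\sum_i c 0 i * (A i j)%:~R) *: e j.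
Proof.
by rewrite lie_suml scaler_suml; apply: eq_bigr => i _;
  rewrite lieZl km_he scalerA.
Qed.

Hypothesis e_neq0 : forall i, e i != 0.

(** Bracketing a relation with the nonzero [e j], for each j, yields a row annihilated by the
    invertible matrix A. *)
Lemma h_free (c : 'rV[K]_n) : \sum_i c 0 i *: h i = 0 -> c = 0.
Proof.
move=> c0; apply: cartan_row_eq0 => j.
have /eqP : lie (\sum_i c 0 i *: h i) (e j) = 0 by rewrite c0 lie0l.
by rewrite lie_cartan_e scaler_eq0 (negPf (e_neq0 j)) orbF => /eqP.
Qed.

Lemma nu_eq0 b : nu b = 0 -> b = 0.
Proof.
move=> b0; have /rowP c0 : \row_i (b 0 i)%:~R = 0 :> 'rV[K]_n.
  by apply: h_free; rewrite -[RHS]b0; apply: eq_bigr => i _; rewrite mxE.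
by apply/rowP => i; have /eqP := c0 i; rewrite !mxE intr_eq0 => /eqP.
Qed.

Lemma h_nu_free i k b (p q : K) : k != i -> b 0 k != 0 ->
  p *: h i = q *: nu b -> p = 0 /\ q = 0.
Proof.
move=> ki bk pq; have /rowP c0 : \row_j (q * (b 0 j)%:~R - p * (j == i)%:R) = 0.
  apply: h_free; transitivity (q *: nu b - p *: h i); last by rewrite pq subrr.
  rewrite /nu scaler_sumr -(nu_alpha K A i) /nu scaler_sumr -sumrB.
  apply: eq_bigr => j _; rewrite !mxE !scalerA -scalerBl eqxx /=.
  by case: (j == i).
have q0 : q = 0.
  have /eqP := c0 k; rewrite !mxE (negPf ki) mulr0 subr0 mulf_eq0 intr_eq0.
  by rewrite (negPf bk) orbF => /eqP.
have /eqP := c0 i; rewrite !mxE q0 mul0r eqxx mulr1 sub0r oppr_eq0 => /eqP.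
by [].
Qed.

Lemma h_neq0 i : h i != 0.
Proof.
apply/eqP => hi0; have := e_neq0 i; have /eqP := km_he K A i i.
by rewrite hi0 lie0l diagA eq_sym scaler_eq0 intr_eq0 /= => ->.
Qed.

Lemma wt_neg_step w x : (1 < size w)%N -> wt (- content w) x ->
  lspan [set y | exists i w' z, [/\ content w = al i + content w',
    wt (- content w') z
     & y = lie (f i) z]] x.
Proof.
move=> w1 /wt_eta; rewrite opprK -{2}[x]etaK => wx.
apply: (@lspan_ind_linear _ _ _ (fun y => lspan _ (eta y)));
  last exact: (wt_step symA detA w1 wx).
- by rewrite linear0; exact: lspan0.
- by move=> u v Hu Hv; rewrite linearD; exact: lspanD.
- by move=> a u Hu; rewrite linearZ; exact: lspanZ.
move=> y [i [w' [z [cw wz ->]]]]; rewrite eta_lie eta_e lieNl; apply: lspanN.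
by apply: lspan_sub; exists i, w', (eta z); split => //; exact: wt_eta.
Qed.

Lemma wt_alphaNMn i k x : (1 < k)%N -> wt (- (al i *+ k)) x -> x = 0.
Proof.
move=> k1 /wt_eta; rewrite opprK => /(wt_alphaMn symA detA k1); exact: eta_eq0.
Qed.

Lemma wt_alphaB i j x : i != j -> wt (al i - al j) x -> x = 0.
Proof.
move=> ij wx; apply/eqP/negPn/negP => x0.
have aij : (al i - al j) 0 i = 1 by rewrite !mxE !eqxx (negPf ij).
have aji : (al i - al j) 0 j = -1.
  by rewrite !mxE !eqxx eq_sym (negPf ij).
case: (wt_sign symA detA wx x0) => -[w cw]; move: aij aji; rewrite cw.
  by rewrite !contentE; lia.
have mN k : (- content w) 0 k = - content w 0 k by rewrite mxE.
by rewrite !mN !contentE; lia.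
Qed.

Definition line b : Prop :=
  forall x y, wt b x -> wt (- b) y -> exists a, lie x y = a *: nu b.

(** The Jacobi identity for [e i], x, y reads $a\,h_i=d\,(h_i+\nu b)+q\,\nu b$; independence of
    $h_i$ and $\nu b$ separates the coefficients. The relation $q=-d$ is the invariance of the
    form. *)
Lemma line_e i k b x y a q d : k != i -> b 0 k != 0 ->
  wt b x -> wt (- (al i + b)) y ->
  lie x y = a *: f i -> lie x (lie (e i) y) = q *: nu b ->
  lie (lie (e i) x) y = d *: nu (al i + b) -> a = d /\ q = - d.
Proof.
move=> ki bk wx wy xy xey exy.
have := lie_derr (e i) x y;
  rewrite xy lieZr km_ef exy xey nuD nu_alpha scalerDr => H.
have /(h_nu_free ki bk) : (a - d) *: h i = (d + q) *: nu b.
  by rewrite scalerBl scalerDl; apply/eqP; rewrite subr_eq H -addrA addrC.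
move=> [/eqP + /eqP]; rewrite subr_eq0 addrC addr_eq0 => /eqP -> /eqP ->.
by split.
Qed.

(** The same comparison for x, [f i], y: $d\,(h_i+\nu b)=q\,\nu b-a\,h_i$. *)
Lemma line_f i k b x y a q d : k != i -> b 0 k != 0 ->
  wt (al i + b) x -> wt (- b) y ->
  lie x y = a *: e i -> lie (lie x (f i)) y = q *: nu b ->
  lie x (lie (f i) y) = d *: nu (al i + b) -> q = d /\ a = - d.
Proof.
move=> ki bk wx wy xy xfy fxy.
have := lie_derr x (f i) y;
  rewrite xy lieZr (lieC (e i)) km_ef xfy fxy nuD nu_alpha scalerN => H.
have /(h_nu_free ki bk) : (d + a) *: h i = (q - d) *: nu b.
  rewrite scalerBl scalerDl; apply/eqP.
  by rewrite eq_sym subr_eq addrAC -scalerDr H subrK.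
move=> [/eqP + /eqP]; rewrite subr_eq0 addrC addr_eq0 => /eqP -> /eqP ->.
by split.
Qed.

(** Induction on the height. With $x=[e_i,x']$ and $y=[f_j,y']$, the Jacobi identity reduces $[x,y]$
    to brackets of opposite root spaces of smaller height, whose coefficients are matched by
    [line_e] and [line_f]. *)
Lemma line_content w : w != [::] -> line (content w).
Proof.
elim: {w}(size w).+1 {-2}w (ltnSn (size w)) => [//|N IH] w wN w0.
case: (ltnP 1 (size w)) => [w1|]; last first.
  case: w {wN} w0 => [|i []] // _ _; rewrite content1 => x y.
  move=> /(wt_alpha symA detA) [a ->] /(wt_alphaN symA detA) [c ->];
    exists (a * c).
  by rewrite lieZl lieZr scalerA km_ef nu_alpha.
suff gen i wi x' j w2 y' : content w = al i + content wi ->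
  wt (content wi) x' ->
    content w = al j + content w2 -> wt (- content w2) y' ->
    exists a, lie (lie (e i) x') (lie (f j) y') = a *: nu (content w).
  move=> x y wx wy; move: x {wx} (wt_step symA detA w1 wx).
  apply: (@lspan_ind_linear _ _ _ (fun x => exists a,
    lie x y = a *: nu (content w))).
  - by exists 0; rewrite lie0l scale0r.
  - by move=> u v [a ua] [c vc]; exists (a + c); rewrite lieDl ua vc scalerDl.
  - by move=> c u [a ua]; exists (c * a); rewrite lieZl ua scalerA.
  move=> _ [i [w2 [x' [cw wx' ->]]]].
  move: y {wy} (wt_neg_step w1 wy).
  apply: (@lspan_ind_linear _ _ _ (fun y => exists a,
    lie (lie (e i) x') y = a *: nu (content w))).
  - by exists 0; rewrite lie0r scale0r.
  - by move=> u v [a ua] [c vc]; exists (a + c); rewrite lieDr ua vc scalerDl.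
  - by move=> c u [a ua]; exists (c * a); rewrite lieZr ua scalerA.
  by move=> _ [j [w3 [y' [cw' wy' ->]]]]; exact: gen cw wx' cw' wy'.
move=> cw wx cw' wy.
have [sw1 sw2] : size w = (size wi).+1 /\ size w = (size w2).+1.
  by split; [have := congr1 (@height n) cw|have := congr1 (@height n) cw'];
    rewrite heightD height_alpha !height_content; lia.
(* [line_e] needs a letter of [w2] other than i, and [line_f] a letter of [wi] other than j. In the
   exceptional cases a factor vanishes, as a vector whose weight is a proper multiple of a simple
   root, or the weight is $\alpha_i+\alpha_j$ and the bracket is computed directly. *)
case: (boolP (all (pred1 i) w2)) => [/all_pred1P w2E|/allPn [k kw2 /= ki]].
  case: (ltnP 1 (size w2)) => [s2|s2].
    have -> : y' = 0 by apply: (wt_alphaNMn (i := i) s2);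
      rewrite -content_nseq -w2E.
    by exists 0; rewrite !lie0r scale0r.
  have {}w2E : w2 = [:: i] by rewrite w2E (_ : size w2 = 1%N) //; lia.
  have wiE : content wi = al j.
    by apply: (@addrI _ (al i)); rewrite -cw cw' w2E content1 addrC.
  move: wy; rewrite w2E content1 => /(wt_alphaN symA detA) [q ->].
  move: wx; rewrite wiE => /(wt_alpha symA detA) [p ->].
  case: (eqVneq i j) => [->|ij].
    by exists 0; rewrite !lieZr liexx scaler0 lie0l scaler0 scale0r.
  exists (p * q * - (A i j)%:~R); rewrite cw wiE -scalerA.
  rewrite !lieZr lieZl scalerA [q * p]mulrC; congr (_ *: _).
  rewrite lie_derl (lie_derr (e j) (f j)) km_ef (km_ef0 _ _ (i :=
    j)) 1?eq_sym //.
  rewrite lie0r addr0 km_hf lieZr km_ef (lie_derr (e i) (f j)) km_ef0 // lie0l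
    add0r.
  rewrite km_ef (lieC (h i)) km_hf nuD !nu_alpha symA !scaleNr opprK lieZr
    km_ef.
  by rewrite scalerDr opprD.
case: (boolP (all (pred1 j) wi)) => [/all_pred1P wiE|/allPn [k' kw1 /= kj]].
  case: (ltnP 1 (size wi)) => [s1|s1].
    have -> : x' = 0 by apply: (wt_alphaMn symA detA (i := j) s1);
      rewrite -content_nseq -wiE.
    by exists 0; rewrite lie0r lie0l scale0r.
  have {}wiE : wi = [:: j] by rewrite wiE (_ : size wi = 1%N) //; lia.
  have /content_alpha w2E : content w2 = al i.
    by apply: (@addrI _ (al j)); rewrite -cw' cw wiE content1 addrC.
  by case/negP: ki; rewrite w2E inE in kw2.
(* The common remainder $w-\alpha_i-\alpha_j$; it is nonzero and has a coordinate outside i and one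
   outside j. *)
pose c := content w2 - al i.
have c2 : content w2 = al i + c by rewrite addrC subrK.
have c1 : content wi = al j + c.
  by apply: (@addrI _ (al i)); rewrite -cw cw' c2 addrCA.
have ck : c 0 k != 0.
  by rewrite !mxE contentE (negPf ki) andbF subr0 eqz_nat -lt0n -has_count
    has_pred1.
have ck' : c 0 k' != 0.
  have -> : c = content wi - al j by rewrite c1 addrC addKr.
  by rewrite !mxE contentE (negPf kj) andbF subr0 eqz_nat -lt0n -has_count
    has_pred1.
have linec : line c.
  move=> u v wu wv; case: (eqVneq u 0) => [->|u0].
    by exists 0; rewrite lie0l scale0r.
  case: (wt_sign symA detA wu u0) => -[w3 cE].
    have w30 : w3 != [::] by apply: contraNneq ck => w30;
      rewrite cE w30 /content big_nil mxE.
    rewrite cE in wu wv *; apply: (IH w3) => //.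
    have := congr1 (@height n) c2;
      rewrite cE heightD height_alpha !height_content.
    by move: wN; lia.
  have := congr1 (@height n) c2;
    rewrite cE heightD heightN height_alpha !height_content => sE.
  have w30 : w3 = [::] by case: w3 sE {cE} => //= *; lia.
  by case/negP: ck; rewrite cE w30 /content big_nil oppr0 mxE.
have line1 : line (content wi) by apply: IH; [lia|case: (wi) sw1 w1 => // ->].
have line2 : line (content w2) by apply: IH; [lia|case: (w2) sw2 w1 => // ->].
pose u := lie x' (f j); pose v := lie (e i) y'.
have wu : wt c u by have := wt_lie wx (wt_f K symA j);
  rewrite c1 addrAC subrr add0r.
have wv : wt (- c) v.
  by have := wt_lie_e symA i wy; rewrite c2 opprD addrA subrr add0r.
have [a ua] : exists a, lie u y' = a *: f i.
  apply: (wt_alphaN symA detA); have := wt_lie wu wy.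
  by rewrite c2 opprD addrCA subrr addr0.
have [c' vc] : exists c', lie x' v = c' *: e j.
  apply: (wt_alpha symA detA); have := wt_lie wx wv.
  by rewrite c1 addrK.
have [q uv] := linec _ _ wu wv.
have weu : wt (content w2) (lie (e i) u) by rewrite c2; exact: wt_lie_e.
have wfv : wt (- content wi) (lie (f j) v).
  by rewrite c1 opprD; exact: wt_lie_f.
have [d ud] := line2 _ _ weu wy.
have [d' vd] := line1 _ _ wx wfv.
rewrite c2 in wy ud *; rewrite c1 in wx vd *.
have [ad qd] := line_e ki ck wu wy ua uv ud.
have [qd' _] := line_f kj ck' wx wv vc uv vd.
have {}vd : lie x' (lie (f j) v) = - a *: nu (al j + c) by rewrite vd -qd' qd
  ad.
(* Expanding both brackets by Jacobi, the terms through u and v give $a\,h_i$ and $a\,\nu(w_i)$,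
   which add up to $a\,\nu(w)$. *)
have -> : lie (lie (e i) x') (lie (f j) y') = a *: nu (content w)
    + (lie (e i) (lie (f j) (lie x' y')) - lie x' (lie (lie (e i) (f j)) y')).
  rewrite lie_derl (lie_derr x') -/u ua lieDr lieZr km_ef.
  rewrite (lie_derr (e i) (f j) y') -/v [lie x' (_ + _)]lieDr vd.
  rewrite cw c1 [nu (al i + _)]nuD nu_alpha scalerDr scaleNr opprD opprK
    -!addrA; congr (_ + _).
  by rewrite [RHS]addrC -!addrA.
(* For $i\neq j$ both correction terms vanish: $[e_i,f_j]=0$, and $[x',y']$ has weight
   $\alpha_j-\alpha_i$. *)
case: (eqVneq i j) => [ij|ij]; last first.
  exists a; rewrite km_ef0 // lie0l lie0r subr0.
  suff -> : lie x' y' = 0 by rewrite !lie0r addr0.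
  apply: (@wt_alphaB j i); first by rewrite eq_sym.
  have := wt_lie wx wy; rewrite opprD addrACA subrr addr0; exact.
rewrite -ij in c1 wx line1 vd wfv *.
(* For $i=j$ the vectors [x'] and [y'] lie in opposite root spaces of smaller height, and the two
   corrections combine into a multiple of $h_i+\nu(w_i)=\nu(w)$. *)
have [r xyr] : exists r, lie x' y' = r *: nu (content wi).
  by apply: line1; rewrite c1.
exists (a + r * (bil (content wi) (al i))%:~R).
rewrite scalerDl; congr (_ + _).
rewrite xyr !lieZr (lieC (nu _)) (lie_nu symA _ (wt_f K symA i)) km_ef.
rewrite wy lieNr !lieZr km_ef xyr -c1 bilNr bilNl !intrN !scaleNr !opprK.
by rewrite !scalerA [_ * r]mulrC -scalerDr cw nuD nu_alpha.
Qed.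

End InvariantForm.

(** * The form on root spaces, its invariance and its dual bases *)

Section Nondegeneracy.
Variables (K : numFieldType) (n : nat) (A : 'M[int]_n).
Hypothesis symA : forall i j, A i j = A j i.
Hypothesis diagA : forall i, A i i = 2.
Hypothesis detA : \det A != 0.

Local Notation g := (kac_moody K A).
Local Notation e := (km_e K A).
Local Notation f := (km_f K A).
Local Notation h := (km_h K A).
Local Notation al := (@alpha n).
Local Notation bil := (bil A).
Local Notation wt := (@wt K n A).
Local Notation nu := (@nu K n A).
Implicit Types (b : 'rV[int]_n) (i j : 'I_n) (w : seq 'I_n) (x y z : g).

Hypothesis e_neq0 : forall i, e i != 0.
Local Notation line := (@line K n A).

Let lineP := line_content symA detA e_neq0.
Let nu_neq0 b : b != 0 -> nu b != 0.
Proof. by apply: contra_neq => /(nu_eq0 detA e_neq0). Qed.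

Lemma content_neq0 w : w != [::] -> content w != 0.
Proof. by apply: contra_neq; exact: content_eq0. Qed.

(* The invariant form on the root space of b and its opposite, read off from
   [x, y] = (x | y) nu b. *)
Definition form b x y : K := xget 0 [set a | lie x y = a *: nu b].

Lemma form_uniq b x y a : b != 0 -> lie x y = a *: nu b -> form b x y = a.
Proof.
move=> b0 xy; rewrite /form; case: xgetP => [a' _|/(_ a)]; last by [].
rewrite /= xy => /eqP; rewrite -subr_eq0 -scalerBl scaler_eq0.
by rewrite (negPf (nu_neq0 b0)) orbF subr_eq0 => /eqP.
Qed.

Lemma formE w x y : w != [::] -> wt (content w) x -> wt (- content w) y ->
  lie x y = form (content w) x y *: nu (content w).
Proof.
move=> w0 wx wy; have [a xy] := lineP w0 wx wy.
by rewrite (form_uniq (content_neq0 w0) xy).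
Qed.

Lemma form_suml w I (r : seq I) (a : I -> K) (F : I -> g) y : w != [::] ->
  (forall k, wt (content w) (F k)) -> wt (- content w) y ->
  form (content w) (\sum_(k <- r) a k *: F k) y =
  \sum_(k <- r) a k * form (content w) (F k) y.
Proof.
move=> w0 wF wy; apply: form_uniq (content_neq0 w0) _.
rewrite lie_suml scaler_suml; apply: eq_bigr => k _.
by rewrite lieZl (formE w0 (wF k) wy) scalerA.
Qed.

Lemma form_sumr w I (r : seq I) (a : I -> K) (F : I -> g) x : w != [::] ->
  (forall k, wt (- content w) (F k)) -> wt (content w) x ->
  form (content w) x (\sum_(k <- r) a k *: F k) =
  \sum_(k <- r) a k * form (content w) x (F k).
Proof.
move=> w0 wF wx; apply: form_uniq (content_neq0 w0) _.
rewrite lie_sumr scaler_suml; apply: eq_bigr => k _.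
by rewrite lieZr (formE w0 wx (wF k)) scalerA.
Qed.

Lemma form_invariant w i x y : w != [::] ->
  wt (content w) x -> wt (- content (i :: w)) y ->
  form (content (i :: w)) (lie (e i) x) y = - form (content w) x (lie (e i) y).
Proof.
move=> w0 wx wy; have iw0 : i :: w != [::] by [].
(* [line_e] needs a letter other than i. If there is none, y has weight a multiple of $-\alpha_i$ by
   at least 2, so it is 0. *)
case: (boolP (all (pred1 i) w)) => [/all_pred1P wE|/allPn [k kw /= ki]].
  have y0 : y = 0.
    apply: (@wt_alphaNMn K n A symA detA i (size (i :: w))).
      by case: (w) w0.
    by rewrite -content_nseq /= -wE.
  rewrite y0 lie0r (form_uniq (a := 0) (content_neq0 iw0)) ?lie0r ?scale0r //.
  by rewrite (form_uniq (a := 0) (content_neq0 w0)) ?oppr0 // lie0r scale0r.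
have wex : wt (content (i :: w)) (lie (e i) x) by rewrite content_cons;
  exact: wt_lie_e.
have wey : wt (- content w) (lie (e i) y).
  by have := wt_lie_e symA i wy; rewrite content_cons opprD addrA subrr add0r.
have [a xy] : exists a, lie x y = a *: f i.
  apply: (wt_alphaN symA detA); have := wt_lie wx wy.
  by rewrite content_cons opprD addrCA subrr addr0.
have exy := formE iw0 wex wy; have xey := formE w0 wx wey.
have wk : content w 0 k != 0 by rewrite contentE eqz_nat -lt0n -has_count
  has_pred1.
rewrite content_cons in wy exy *.
have [_ ->] := line_e detA e_neq0 ki wk wx wy xy xey exy.
by rewrite opprK.
Qed.

Definition nondegenerate b : Prop :=
  forall x, wt b x -> (forall y, wt (- b) y -> lie x y = 0) -> x = 0.

Lemma nondegenerate_right b y : nondegenerate b -> wt (- b) y ->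
  (forall x, wt b x -> lie x y = 0) -> y = 0.
Proof.
move=> ndb wy xy; apply: eta_eq0; apply: ndb => [|z wz].
  by rewrite -[b]opprK; exact: wt_eta.
have /xy : wt b (eta z) by rewrite -[b]opprK; exact: wt_eta.
by move=> /(congr1 (@eta K n A)); rewrite eta_lie etaK linear0 (lieC z) => ->;
  rewrite oppr0.
Qed.

(* Dual bases of the root space of b and its opposite; since the vectors need
   not be linearly independent this is the canonical tensor of the form. *)
Definition dual b (s : seq (g * g)) : Prop :=
  [/\ forall p, p \in s -> wt b p.1 /\ wt (- b) p.2,
      forall x, wt b x -> x = \sum_(p <- s) form b x p.2 *: p.1
    & forall y, wt (- b) y -> y = \sum_(p <- s) form b p.1 y *: p.2].

(** The spanning families are indexed by all words of the right length, words of another content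
    being replaced by 0. They may be dependent, so their Gram matrix may be singular; a generalized
    inverse takes the place of the inverse. *)
Lemma dual_exists w : w != [::] -> nondegenerate (content w) ->
  exists s, dual (content w) s.
Proof.
move=> w0 ndw; set b := content w.
pose N := #|{: (size w).-tuple 'I_n}|.
pose V (k : 'I_N) := if content (enum_val k) == b then word e (enum_val k) else
  0.
pose W (k : 'I_N) := if content (enum_val k) == b then word f (enum_val k) else
  0.
have wV k : wt b (V k).
  by rewrite /V; case: eqP => [<-|_]; [exact: wt_word_e|exact: wt0].
have wW k : wt (- b) (W k).
  by rewrite /W; case: eqP => [<-|_]; [exact: wt_word_f|exact: wt0].
have ind w' : content w' = b -> exists k : 'I_N, enum_val k = w' :> seq 'I_n.
  move=> w'b; have sw : size w' == size w.
    by have := congr1 (@height n) w'b; rewrite !height_content => -[->].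
  by exists (enum_rank (Tuple sw)); rewrite enum_rankK.
have spanV x : wt b x -> exists a : 'rV[K]_N, x = \sum_k a 0 k *: V k.
  move=> /(wt_pos symA detA w0).
  apply: (@lspan_ind_linear _ _ _ (fun x => exists a : 'rV_N,
    x = \sum_k a 0 k *: V k)).
  - by exists 0; rewrite big1 // => k _; rewrite mxE scale0r.
  - move=> u v [a ->] [c ->]; exists (a + c); rewrite -big_split.
    by apply: eq_bigr => k _; rewrite mxE scalerDl.
  - move=> t u [a ->]; exists (t *: a); rewrite scaler_sumr.
    by apply: eq_bigr => k _; rewrite mxE scalerA.
  - move=> _ [w' w'b ->]; have [k kw] := ind _ w'b; exists (delta_mx 0 k).
    rewrite (bigD1 k) //= mxE !eqxx scale1r /V kw w'b eqxx big1 ?addr0 // =>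
      l /negPf lk.
    by rewrite mxE lk andbF scale0r.
have spanW y : wt (- b) y -> exists a : 'rV[K]_N, y = \sum_k a 0 k *: W k.
  move=> /(wt_neg symA detA w0).
  apply: (@lspan_ind_linear _ _ _ (fun y => exists a : 'rV_N,
    y = \sum_k a 0 k *: W k)).
  - by exists 0; rewrite big1 // => k _; rewrite mxE scale0r.
  - move=> u v [a ->] [c ->]; exists (a + c); rewrite -big_split.
    by apply: eq_bigr => k _; rewrite mxE scalerDl.
  - move=> t u [a ->]; exists (t *: a); rewrite scaler_sumr.
    by apply: eq_bigr => k _; rewrite mxE scalerA.
  - move=> _ [w' w'b ->]; have [k kw] := ind _ w'b; exists (delta_mx 0 k).
    rewrite (bigD1 k) //= mxE !eqxx scale1r /W kw w'b eqxx big1 ?addr0 // =>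
      l /negPf lk.
    by rewrite mxE lk andbF scale0r.
(* Only $GCG=G$ is available, not $GC=1$. It shows that a vector minus its proposed expansion pairs
   to zero with the opposite root space; nondegeneracy then makes the difference vanish. *)
pose G : 'M[K]_N := \matrix_(k, l) form b (V k) (W l).
pose C := pinvmx G.
have GCG : G *m C *m G = G by rewrite mulmxKpV.
have formVW (a c : 'rV[K]_N) :
    form b (\sum_k a 0 k *: V k) (\sum_k c 0 k *: W k) = (a *m G *m c^T) 0 0.
  rewrite form_suml //; last by apply: wt_sum => k _; exact: wtZ.
  under eq_bigr do rewrite form_sumr //.
  rewrite mxE; under [RHS]eq_bigr do rewrite !mxE mulr_suml.
  rewrite exchange_big; apply: eq_bigr => k _; rewrite mulr_sumr.
  by apply: eq_bigr => l _; rewrite mxE [RHS]mulrAC mulrA.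
have formW x y (a c : 'rV[K]_N) : x = \sum_k a 0 k *: V k ->
  y = \sum_k c 0 k *: W k ->
    a *m G *m c^T = 0 -> lie x y = 0.
  move=> -> -> acG; rewrite (formE w0) ?formVW ?acG ?mxE ?scale0r //.
  - by apply: wt_sum => k _; exact: wtZ.
  - by apply: wt_sum => k _; exact: wtZ.
have rowB (u v : 'rV[K]_N) k : (u - v) 0 k = u 0 k - v 0 k by rewrite !mxE.
pose W' k := \sum_l C l k *: W l.
have wW' k : wt (- b) (W' k) by apply: wt_sum => l _; exact: wtZ.
exists [seq (V k, W' k) | k <- enum 'I_N]; split.
- by move=> _ /mapP [k _ ->]; split; [exact: wV|exact: wW'].
- move=> x wx; have [a xa] := spanV x wx; rewrite big_map big_enum /=.
  have W'E k : form b x (W' k) = (a *m G *m C) 0 k.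
    have -> : W' k = \sum_l (col k C)^T 0 l *: W l.
      by apply: eq_bigr => l _; rewrite !mxE.
    by rewrite xa formVW trmxK colE !mulmxA -colE mxE.
  apply/eqP; rewrite -subr_eq0; apply/eqP; apply: ndw => [|y wy].
    by apply: wtB => //; apply: wt_sum => k _; exact: wtZ.
  have [c yc] := spanW y wy; apply: (formW _ _ (a - a *m G *m C) c _ yc).
    rewrite xa -sumrB; apply: eq_bigr => k _.
    by rewrite -xa W'E -scalerBl rowB.
  by rewrite !mulmxBl -[a *m G *m C *m G]mulmxA -[a *m G *m _]mulmxA [G *m (C
    *m G)]mulmxA GCG subrr.
- move=> y wy; have [c yc] := spanW y wy; rewrite big_map big_enum /=.
  pose c' : 'rV_N := (C *m G *m c^T)^T.
  have sumE : \sum_k form b (V k) y *: W' k = \sum_l c' 0 l *: W l.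
    transitivity (\sum_k \sum_l (form b (V k) y * C l k) *: W l).
      by apply: eq_bigr => k _; rewrite /W' scaler_sumr; apply: eq_bigr => l _;
        rewrite scalerA.
    rewrite exchange_big; apply: eq_bigr => l _; rewrite -scaler_suml;
      congr (_ *: _).
    rewrite [c' _ _]mxE -mulmxA mxE; apply: eq_bigr => k _.
    have -> : V k = \sum_j (delta_mx 0 k : 'rV_N) 0 j *: V j.
      rewrite (bigD1 k) //= mxE !eqxx scale1r big1 ?addr0 // => j /negPf jk.
      by rewrite mxE jk andbF scale0r.
    by rewrite yc formVW -mulmxA -rowE mxE mulrC.
  apply/eqP; rewrite -subr_eq0; apply/eqP;
    apply: (nondegenerate_right ndw) => [|x wx].
    by apply: wtB => //; apply: wt_sum => k _; exact: wtZ.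
  have [a xa] := spanV x wx; apply: (formW _ _ a (c - c') xa).
    rewrite sumE yc -sumrB; apply: eq_bigr => k _.
    by rewrite -scalerBl rowB.
  by rewrite linearB /= /c' trmxK mulmxBr
    -(mulmxA a G (C *m G *m c^T)) (mulmxA G) (mulmxA G C) GCG mulmxA subrr.
Qed.

End Nondegeneracy.

(** * The Gabber-Kac theorem *)

Section GabberKac.
Variables (K : numFieldType) (n : nat) (A : 'M[int]_n).
Hypothesis symA : forall i j, A i j = A j i.
Hypothesis diagA : forall i, A i i = 2.
Hypothesis detA : \det A != 0.

Local Notation g := (kac_moody K A).
Local Notation e := (km_e K A).
Local Notation f := (km_f K A).
Local Notation h := (km_h K A).
Local Notation al := (@alpha n).
Local Notation bil := (bil A).
Local Notation wt := (@wt K n A).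
Local Notation nu := (@nu K n A).
Implicit Types (b : 'rV[int]_n) (i j : 'I_n) (w : seq 'I_n) (x y z : g).

Hypothesis e_neq0 : forall i, e i != 0.
Local Notation form := (@form K n A).
Local Notation dual := (@dual K n A).
Local Notation nondegenerate := (@nondegenerate K n A).

(** Elements of height m that are not roots are listed too; their weight spaces are zero, so their
    dual vectors are zero and contribute nothing. *)
Definition contents m : seq 'rV[int]_n :=
  undup [seq content (val t) | t <- enum {: m.-tuple 'I_n}].

Lemma contentsP m b : reflect (exists2 w,
  size w = m & b = content w) (b \in contents m).
Proof.
rewrite mem_undup; apply: (iffP mapP) => [[t _ ->]|[w /eqP sw ->]].
  by exists (val t); rewrite ?size_tuple.
by exists (Tuple sw); rewrite ?mem_enum.
Qed.

Lemma contents_uniq m : uniq (contents m). Proof. exact: undup_uniq. Qed.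

Definition canonical_dual b : seq (g * g) := xget [::] [set s | dual b s].

Lemma canonical_dualP w : w != [::] -> nondegenerate (content w) ->
  dual (content w) (canonical_dual (content w)).
Proof.
move=> w0 ndw; have [s ds] := dual_exists symA detA e_neq0 w0 ndw.
by rewrite /canonical_dual; case: xgetP => [s' _ //|/(_ s)].
Qed.

(* The part of the Casimir operator that comes from the positive roots of
   height less than m. *)
Definition casimir m x : g :=
  \sum_(1 <= k < m) \sum_(b <- contents k) \sum_(p <- canonical_dual b)
    lie p.1 (lie p.2 x).

Fact casimir_is_linear m : linear (casimir m).
Proof.
move=> a x y; rewrite /casimir scaler_sumr -big_split; apply: eq_bigr => k _.
rewrite scaler_sumr -big_split; apply: eq_bigr => b _.
rewrite scaler_sumr -big_split; apply: eq_bigr => p _.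
by rewrite !linearP.
Qed.
HB.instance Definition _ m := GRing.isLinear.Build K g g *:%R (casimir m)
  (casimir_is_linear m).

Variable N : nat.
Hypothesis ndN : forall w, w != [::] -> (size w < N)%N ->
  nondegenerate (content w).

Let dualP w : w != [::] -> (size w < N)%N ->
  dual (content w) (canonical_dual (content w)).
Proof. by move=> w0 wN; apply: canonical_dualP => //; exact: ndN. Qed.

(** Invariance of the canonical tensors: $[e_j,p_2]$ is expanded in the dual vectors for w, the form
    moves $e_j$ to the other side, and summing over p rebuilds $[e_j,q_1]$. The bound [N.-1] keeps
    the longer word below N as well. *)
Lemma sum_dual_shift w j z : w != [::] -> (size w < N.-1)%N ->
  \sum_(p <- canonical_dual (content (j :: w))) lie p.1 (lie (lie p.2 (e j)) z)
    =
  - \sum_(p <- canonical_dual (content w)) lie (lie p.1 (e j)) (lie p.2 z).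
Proof.
move=> w0 wN; have jw0 : j :: w != [::] by [].
have wN1 : (size w < N)%N by lia.
have jwN : (size (j :: w) < N)%N by rewrite /=; lia.
have [wd _ dr] := dualP w0 wN1; have [wd' dl' _] := dualP jw0 jwN.
transitivity (- \sum_(p <- canonical_dual (content (j :: w)))
    \sum_(q <- canonical_dual (content w))
      form (content w) q.1 (lie (e j) p.2) *: lie p.1 (lie q.2 z)).
  rewrite -sumrN big_seq [RHS]big_seq; apply: eq_bigr => p /wd' [_ wp2].
  have wep : wt (- content w) (lie (e j) p.2).
    by have := wt_lie_e symA j wp2;
      rewrite content_cons opprD addrA subrr add0r.
  rewrite (lieC (e j)) lieNl lieNr {1}(dr _ wep) lie_suml lie_sumr.
  by congr (- _); apply: eq_bigr => q _; rewrite lieZl lieZr.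
rewrite exchange_big; congr (- _) => /=.
rewrite big_seq [RHS]big_seq; apply: eq_bigr => q /wd [wq1 _].
have weq : wt (content (j :: w)) (lie (e j) q.1).
  by rewrite content_cons; exact: wt_lie_e.
rewrite (lieC (e j)) lieNl {1}(dl' _ weq) lie_suml -sumrN.
rewrite big_seq [RHS]big_seq; apply: eq_bigr => p /wd' [_ wp2].
by rewrite (form_invariant symA detA e_neq0 w0 wq1 wp2) scaleNr lieNl lieZl
  opprK.
Qed.

(** Only $\alpha_j$ contributes, because $[f_i,e_j]=0$ for $i\neq j$. *)
Lemma sum_dual_simple j z : (1 < N)%N ->
  \sum_(b <- contents 1) \sum_(p <- canonical_dual b) lie p.1 (lie (lie p.2 (e
    j)) z)
  = - lie (e j) (lie (h j) z).
Proof.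
move=> N1; have jc : al j \in contents 1.
  by apply/contentsP; exists [:: j]; rewrite ?content1.
rewrite (bigD1_seq _ jc (contents_uniq _)) /= addrC big_seq_cond big1 ?add0r;
  last first.
  move=> _ /andP [/contentsP [[|i []] // _ ->] ij].
  rewrite big_seq big1 // => p; have [wd _ _] := dualP (w := [:: i]) isT N1.
  move=> /wd [_]; rewrite content1 in ij *;
    move=> /(wt_alphaN symA detA) [a ->].
  have {}ij : j != i by apply: contraNneq ij => ->.
  by rewrite lieZl (lieC (e j)) km_ef0 // oppr0 scaler0 lie0l lie0r.
have := dualP (w := [:: j]) isT N1; rewrite content1 => -[wd dl _].
have jw0 : content [:: j] != 0 by apply: content_neq0.
rewrite {2}(dl _ (wt_e K symA j)) lie_suml -sumrN.
rewrite big_seq [RHS]big_seq; apply: eq_bigr => p /wd [_].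
move=> /(wt_alphaN symA detA) [a ->];
  have -> : form (al j) (e j) (a *: f j) = a.
  by apply: (form_uniq detA e_neq0);
    rewrite -?content1 // content1 lieZr km_ef nu_alpha.
by rewrite !lieZl (lieC (e j) (f j)) km_ef lieNl scalerN lieNr lieZr.
Qed.

Lemma sum_dual_positive m j z : (0 < m)%N -> (m.+1 < N)%N ->
  \sum_(b <- contents m.+1) \sum_(p <- canonical_dual b) lie p.1 (lie (lie p.2
    (e j)) z)
  = - \sum_(b <- contents m) \sum_(p <- canonical_dual b) lie (lie p.1 (e j))
    (lie p.2 z).
Proof.
move=> m0 mN; pose s := [seq al j + b | b <- contents m].
have us : uniq s by rewrite map_inj_uniq ?contents_uniq //; exact: addrI.
have -> : \sum_(b <- contents m.+1) \sum_(p <- canonical_dual b)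
      lie p.1 (lie (lie p.2 (e j)) z) =
    \sum_(b <- s) \sum_(p <- canonical_dual b) lie p.1 (lie (lie p.2 (e j)) z).
  (* If b is not $\alpha_j$ plus a sum of m simple roots, then $[p_2,e_j]$ has weight $\alpha_j-b$,
     of negative height but not the opposite of a sum of simple roots, so it vanishes. *)
  rewrite (bigID (mem s)) /= [X in _ + X]big_seq_cond [X in _ + X]big1 ?addr0;
    last first.
    move=> b /andP [/contentsP [w sw ->] wjs]; rewrite big_seq big1 // => p.
    have w0 : w != [::] by case: w sw {wjs}.
    have wN : (size w < N)%N by rewrite sw.
    have [wd _ _] := dualP w0 wN.
    move=> /wd [_ wp2]; have we := wt_lie wp2 (wt_e K symA j).
    suff -> : lie p.2 (e j) = 0 by rewrite lie0l lie0r.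
    apply/eqP/negPn/negP => pe0.
    case: (wt_sign symA detA we pe0) => -[w' /eqP].
      rewrite addrC subr_eq => /eqP /(congr1 (@height n)).
      by rewrite heightD height_alpha !height_content sw; lia.
    rewrite addrC -subr_eq0 opprK addrAC subr_eq0 => /eqP cw.
    have sw' := congr1 (@height n) cw.
    rewrite heightD height_alpha !height_content sw in sw'.
    case/negP: wjs; apply/mapP; exists (content w') => //.
    by apply/contentsP; exists w' => //; lia.
  rewrite -big_filter; apply: perm_big; apply: uniq_perm => //.
    by rewrite filter_uniq ?contents_uniq.
  move=> b; rewrite mem_filter;
    apply: andb_idr => /mapP [c /contentsP [w sw ->] ->].
  by apply/contentsP; exists (j :: w); rewrite ?content_cons //= sw.
rewrite /s big_map -sumrN big_seq [RHS]big_seq.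
apply: eq_bigr => c /contentsP [w sw ->];
  rewrite -content_cons sum_dual_shift //.
  by case: w sw m0 => // <-.
by rewrite sw; lia.
Qed.

(** For b of the same height as z the bracket [lie p.2 z] has height 0, and 0 is the only weight of
    height 0 with nonzero vectors. *)
Lemma sum_dual_top w z (F : g * g -> g) : w != [::] -> (size w < N)%N ->
  wt (content w) z -> (forall p, lie p.2 z = 0 -> F p = 0) ->
  \sum_(b <- contents (size w)) \sum_(p <- canonical_dual b) F p =
  \sum_(p <- canonical_dual (content w)) F p.
Proof.
move=> w0 wN wz F0; have wc : content w \in contents (size w).
  by apply/contentsP; exists w.
rewrite (bigD1_seq _ wc (contents_uniq _)) /= [X in _ + X]big_seq_cond [X in _
  + X]big1 ?addr0 //.
move=> _ /andP [/contentsP [w' sw' ->] ww']; rewrite big_seq big1 // => p.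
have w'0 : w' != [::] by rewrite -size_eq0 sw' size_eq0.
have w'N : (size w' < N)%N by rewrite sw'.
have [wd _ _] := dualP w'0 w'N.
move=> /wd [_ wp2]; apply: F0; have wpz := wt_lie wp2 wz.
apply/eqP/negPn/negP => pz0; case/negP: ww'; rewrite eq_sym -subr_eq0 addrC.
have hw : height (- content w' + content w) = 0.
  by rewrite heightD heightN !height_content sw' addNr.
case: (wt_sign symA detA wpz pz0) => -[w'' cw]; move: hw; rewrite cw.
  by rewrite height_content; case: w'' {cw} => // _; rewrite /content big_nil.
by rewrite heightN height_content; case: w'' {cw} => // _;
  rewrite /content big_nil oppr0.
Qed.

Lemma lie_dual_top w z (p : g * g) : w != [::] -> wt (content w) z ->
  wt (- content w) p.2 -> lie p.2 z = - form (content w) z p.2 *: nu (content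
    w).
Proof. by move=> w0 wz wp; rewrite lieC (formE symA detA e_neq0 w0 wz wp)
  scaleNr. Qed.

(** Induction on the height with $x=[e_j,z]$: moving $e_j$ outwards through the double brackets
    leaves sums that telescope, so only boundary terms of lowest and highest level remain. *)
Lemma casimir_scalar w x : w != [::] -> (size w <= N)%N -> wt (content w) x ->
  casimir (size w) x = ((size w).*2%:Z - bil (content w) (content w))%:~R *: x.
Proof.
elim: {w}(size w) {-2}w (erefl (size w)) x => [|m IH] w sw x;
  first by case: w sw.
move=> w0 mN wx; case: (posnP m) => [m0|m0].
  case: w sw w0 wx {mN} => [|i [|]] //=; last by rewrite m0.
  move=> _ _ wx; rewrite /casimir big_geq // content1 bil_alpha diagA.
  by rewrite subrr scale0r.
have w1 : (1 < size w)%N by rewrite sw.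
move: x {wx} (wt_step symA detA w1 wx); rewrite sw.
set t := ((m.+1).*2%:Z - _)%:~R.
apply: (@lspan_ind_linear _ _ _ (fun x => casimir m.+1 x = t *: x)).
- by rewrite linear0 scaler0.
- by move=> u v Hu Hv; rewrite linearD /= Hu Hv scalerDr.
- by move=> a u Hu; rewrite linearZ /= Hu !scalerA mulrC.
move=> _ [j [w' [z [cw wz ->]]]]; rewrite {}/t.
have sw' : size w' = m.
  have := congr1 (@height n) cw;
    rewrite heightD height_alpha !height_content sw; lia.
have w'0 : w' != [::] by rewrite -size_eq0 sw' -lt0n.
have w'N : (size w' < N)%N by rewrite sw' -sw.
have [wd dl _] := dualP w'0 w'N.
pose S2 k := \sum_(b <- contents k) \sum_(p <- canonical_dual b)
   lie (lie p.1 (e j)) (lie p.2 z).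
have casE : casimir m.+1 (lie (e j) z) =
    \sum_(1 <= k < m.+1) \sum_(b <- contents k) \sum_(p <- canonical_dual b)
      lie p.1 (lie (lie p.2 (e j)) z) + \sum_(1 <= k < m.+1) S2 k
    + lie (e j) (casimir m.+1 z).
  rewrite /casimir lie_sumr -!big_split; apply: eq_bigr => k _ /=.
  rewrite /S2 lie_sumr -!big_split; apply: eq_bigr => b _ /=.
  rewrite lie_sumr -!big_split; apply: eq_bigr => p _ /=.
  by rewrite (lie_derr p.2) lieDr (lie_derr p.1 (e j)) addrA.
(* The part of level k + 1 cancels [S2 k]; what survives is the level 1 term here and [S2 m] at the
   top. *)
have S1E : \sum_(1 <= k < m.+1) \sum_(b <- contents k) \sum_(p <-
  canonical_dual b)
      lie p.1 (lie (lie p.2 (e j)) z) =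
    - lie (e j) (lie (h j) z) - \sum_(1 <= k < m) S2 k.
  rewrite big_ltn // sum_dual_simple; last lia.
  congr (_ + _); rewrite big_add1 -sumrN big_nat [RHS]big_nat.
  by apply: eq_bigr => k /andP [k0 km]; rewrite sum_dual_positive //; lia.
have S2E : S2 m = - (bil (content w') (content w))%:~R *: lie (e j) z.
  rewrite /S2 -sw' (sum_dual_top w'0 w'N wz) => [|p ->]; last by rewrite lie0r.
  rewrite (lieC z) scalerN scaleNr opprK {2}(dl _ wz) lie_suml scaler_sumr.
  rewrite big_seq [RHS]big_seq; apply: eq_bigr => p /wd [wp1 wp2].
  rewrite (lie_dual_top w'0 wz wp2) lieZr (lieC (nu _)) lieZl (lie_nu symA _
    (wt_lie wp1 (wt_e K symA j))).
  by rewrite scaleNr scalerN opprK addrC -cw !scalerA mulrC.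
have TE : \sum_(b <- contents m) \sum_(p <- canonical_dual b) lie p.1 (lie p.2
  z)
    = (bil (content w') (content w'))%:~R *: z.
  rewrite -sw' (sum_dual_top w'0 w'N wz) => [|p ->]; last by rewrite lie0r.
  rewrite {2}(dl _ wz) scaler_sumr big_seq [RHS]big_seq;
    apply: eq_bigr => p /wd [wp1 wp2].
  rewrite (lie_dual_top w'0 wz wp2) lieZr (lieC (nu _)) (lie_nu symA _ wp1).
  by rewrite scaleNr scalerN opprK !scalerA mulrC.
(* One level more than in the induction hypothesis: the extra level is that of z itself and adds
   $(w',w')$, which cancels the norm. *)
have cz : casimir m.+1 z = (m.*2%:Z)%:~R *: z.
  have := IH w' sw' z w'0 (ltnW w'N) wz; rewrite sw' => cz.
  by rewrite /casimir big_nat_recr //= TE -/(casimir m z) cz -scalerDl -intrD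
    subrK.
rewrite casE S1E big_nat_recr //= S2E cz wz !lieZr.
have cancel (u v t : g) : u - t + (t + v) = u + v by rewrite addrA subrK.
rewrite cancel -!scaleNr -!scalerDl -!intrN -!intrD; congr (_%:~R *: _).
rewrite cw !bilDl !bilDr bil_alpha diagA (bilC symA (al j)).
by rewrite doubleS; lia.
Qed.

End GabberKac.

Section GabberKacTheorem.
Variables (K : numFieldType) (n : nat) (A : 'M[int]_n).
Hypothesis symA : forall i j, A i j = A j i.
Hypothesis diagA : forall i, A i i = 2.
Hypothesis detA : \det A != 0.

Local Notation g := (kac_moody K A).
Local Notation e := (km_e K A).
Local Notation f := (km_f K A).
Local Notation h := (km_h K A).
Local Notation al := (@alpha n).
Local Notation bil := (bil A).
Local Notation wt := (@wt K n A).
Local Notation nu := (@nu K n A).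
Implicit Types (b : 'rV[int]_n) (i j : 'I_n) (w : seq 'I_n) (x y z : g).

Hypothesis e_neq0 : forall i, e i != 0.

Lemma lie_word_f_eq0 w x : (forall i, lie (f i) x = 0) -> lie (word f w) x = 0.
Proof.
move=> fx; elim: w => [|i w IH]; first by rewrite lie0l.
case: (eqVneq w [::]) => [->|w0]; first exact: fx.
by rewrite word_cons // lie_derl IH fx !lie0r subrr.
Qed.

Theorem gabber_kac w : w != [::] -> @nondegenerate K n A (content w).
Proof.
elim: {w}(size w).+1 {-2}w (ltnSn (size w)) => [//|N IH] w wN w0 x wx xy.
case: (ltnP 1 (size w)) => [w1|]; last first.
  case: w {wN} w0 wx xy => [|i []] // _;
    rewrite content1 => /(wt_alpha symA detA) [a ->] xy _.
  have /eqP := xy _ (wt_f K symA i); rewrite lieZl km_ef scaler_eq0.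
  by rewrite (negPf (h_neq0 diagA e_neq0 i)) orbF => /eqP ->; rewrite scale0r.
apply/eqP/negPn/negP => x0.
have lineP := line_content symA detA e_neq0.
(* By induction it suffices that $[[x,f_i],z]=0$ for opposite z. This bracket is a multiple of
   $h_i$, since $[x,[f_i,z]]=0$, and also of [nu] of a weight with a coordinate outside i; so it is
   0. *)
have xf i : lie x (f i) = 0.
  apply/eqP/negPn/negP => u0; have wu := wt_lie wx (wt_f K symA i).
  have hu : height (content w - al i) = (size w).-1.
    by rewrite heightD heightN height_alpha height_content; lia.
  case: (wt_sign symA detA wu u0) => -[w' cw]; last first.
    by move: hu; rewrite cw heightN height_content; lia.
  have sw' : size w' = (size w).-1 by move: hu;
    rewrite cw height_content => -[].
  have w'0 : w' != [::] by rewrite -size_eq0 sw'; lia.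
  have {cw} cw : content w = al i + content w' by rewrite -cw addrC subrK.
  case: (boolP (all (pred1 i) w')) => [/all_pred1P w'E|/allPn [k kw /= ki]].
    case/eqP: x0; apply: (@wt_alphaMn K n A symA detA i (size w').+1);
      first lia.
    by rewrite mulrS -content_nseq -w'E -cw.
  have wk : content w' 0 k != 0 by rewrite contentE eqz_nat -lt0n -has_count
    has_pred1.
  have wu' : wt (content w') (lie x (f i)) by move: wu;
    rewrite cw addrAC subrr add0r.
  case/eqP: u0; apply: (IH w') => // [|z wz]; first lia.
  have [a xza] : exists a, lie x z = a *: e i.
    by apply: (wt_alpha symA detA); have := wt_lie wx wz; rewrite cw addrK.
  have fz : lie x (lie (f i) z) = 0.
    by apply: xy; rewrite cw opprD; exact: wt_lie_f.
  have [c uz] := lineP _ w'0 _ _ wu' wz.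
  have uzh : lie (lie x (f i)) z = a *: h i.
    by rewrite lie_derl fz xza lieZr (lieC (e i)) km_ef scalerN opprK add0r.
  have [a0 _] := h_nu_free detA e_neq0 ki wk (etrans (esym uzh) uz).
  by rewrite uzh a0 scale0r.
have fx i : lie (f i) x = 0 by rewrite lieC xf oppr0.
have neg i : bil (content w) (al i) <= 0.
  rewrite leNgt; apply/negP => pos; case/eqP: x0.
  by apply: (sl2_injective symA diagA detA (k := 1) wx _ (fx i)); lia.
have neg_norm : bil (content w) (content w) <= 0.
  rewrite bil_sumr; apply: sumr_le0 => i _; apply: mulr_ge0_le0 => //.
  by rewrite contentE.
have ndN w' : w' != [::] -> (size w' < size w)%N ->
  @nondegenerate K n A (content w').
  by move=> w'0 ww'; apply: IH => //; lia.
(* Every [p.2] is a combination of words in the [f i], which all kill x; so the operator gives 0 on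
   x although its scalar is positive. *)
have := casimir_scalar symA diagA detA e_neq0 ndN w0 (leqnn _) wx.
rewrite /casimir big_nat big1 => [/esym/eqP|k /andP [k0 kw]].
  by rewrite scaler_eq0 (negPf x0) orbF intr_eq0 => /eqP; move: w1 neg_norm;
    lia.
rewrite big_seq big1 // => b /contentsP [w' sw' ->].
have w'0 : w' != [::] by rewrite -size_eq0 sw' -lt0n.
have w'N : (size w' < size w)%N by rewrite sw'.
rewrite big_seq big1 // => p.
have [wd _ _] := canonical_dualP symA detA e_neq0 w'0 (ndN _ w'0 w'N).
move=> /wd [_ /(wt_neg symA detA w'0)]; elim=> [|a u v [w2 _ ->] _ IHp].
  by rewrite lie0l lie0r.
by rewrite lieDl lieZl lie_word_f_eq0 // scaler0 add0r.
Qed.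

End GabberKacTheorem.

(** * Morphisms that do not kill the simple root vectors *)

Section Injectivity.
Variables (K : numFieldType) (n : nat) (A : 'M[int]_n).
Hypothesis symA : forall i j, A i j = A j i.
Hypothesis diagA : forall i, A i i = 2.
Hypothesis detA : \det A != 0.

Local Notation g := (kac_moody K A).
Local Notation e := (km_e K A).
Local Notation f := (km_f K A).
Local Notation h := (km_h K A).
Local Notation al := (@alpha n).
Local Notation bil := (bil A).
Local Notation wt := (@wt K n A).
Local Notation nu := (@nu K n A).
Implicit Types (b : 'rV[int]_n) (i j : 'I_n) (w : seq 'I_n) (x y z : g).

Variables (L : lieAlgType K) (phi : g -> L).
Hypothesis phi_morph : lie_morphism phi.
Hypothesis phi_e : forall i, phi (e i) != 0.

(** The kernel is an ideal, hence graded by weights. It meets the Cartan subalgebra trivially, so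
    its component of weight b brackets to zero with the opposite root space, and nondegeneracy kills
    it. *)
Theorem kac_moody_morphism_injective : injective phi.
Proof.
have [phiD phiZ phi_lie] := phi_morph.
have phi0 : phi 0 = 0 by rewrite -(scale0r 0) phiZ scale0r.
have phiN x : phi (- x) = - phi x by rewrite -scaleN1r phiZ scaleN1r.
have e_neq0 i : e i != 0 by apply: contra_neq (phi_e i) => ->.
(* A Cartan element in the kernel has value 0 on every simple root, because its bracket with [e j]
   is a multiple of [e j] and [phi (e j)] is nonzero. *)
have kcartan x : wt 0 x -> phi x = 0 -> x = 0.
  move=> /(wt_cartan symA detA) hx;
    have [c ->] : exists c : 'rV[K]_n, x = \sum_i c 0 i *: h i.
    move: x hx; apply: lspan_ind_linear.
    - by exists 0; rewrite big1 // => i _; rewrite mxE scale0r.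
    - move=> u v [c ->] [d ->]; exists (c + d); rewrite -big_split.
      by apply: eq_bigr => i _; rewrite mxE scalerDl.
    - move=> a u [c ->]; exists (a *: c); rewrite scaler_sumr.
      by apply: eq_bigr => i _; rewrite mxE scalerA.
    - move=> _ [i ->]; exists (delta_mx 0 i);
        rewrite (bigD1 i) //= mxE !eqxx scale1r.
      by rewrite big1 ?addr0 // => j /negPf ji; rewrite mxE ji andbF scale0r.
  move=> c0; suff -> : c = 0 by rewrite big1 // => i _; rewrite mxE scale0r.
  apply: (cartan_row_eq0 detA) => j; have /eqP := lie_cartan_e A c j.
  move=> /eqP /(congr1 phi); rewrite phi_lie c0 lie0l phiZ => /esym/eqP.
  by rewrite scaler_eq0 (negPf (phi_e j)) orbF => /eqP.
have kwt b y : wt b y -> phi y = 0 -> y = 0.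
  move=> wy y0; apply/eqP/negPn/negP => yn0.
  have kbr z : wt (- b) z -> lie y z = 0.
    move=> wz; apply: kcartan; last by rewrite phi_lie y0 lie0l.
    by have := wt_lie wy wz; rewrite subrr.
  case: (wt_sign symA detA wy yn0) => -[w bw]; case: (eqVneq w [::]) => w0.
  - by case/eqP: yn0; apply: kcartan y0; move: wy;
      rewrite bw w0 /content big_nil.
  - case/eqP: yn0; apply: (gabber_kac symA diagA detA e_neq0 w0);
      rewrite -bw //.
  - by case/eqP: yn0; apply: kcartan y0; move: wy;
      rewrite bw w0 /content big_nil oppr0.
  - case/eqP: yn0; apply: (nondegenerate_right (gabber_kac symA diagA detA
      e_neq0 w0)).
      by rewrite -bw.
    by move=> z wz; rewrite lieC kbr ?oppr0 // bw opprK.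
have ker x : phi x = 0 -> x = 0.
  have [s [X [us HX ->]]] := weight_decomposition symA x => x0.
  have wX b : wt b (X b).
    move: (X b) (HX b); apply: lspan_ind_linear;
      [exact: wt0|exact: wtD|exact: wtZ|].
    exact: weight_vector_wt.
  rewrite big_seq big1 // => b bs; apply: (kwt b) => //.
  apply: (@graded_components K n A detA (fun y => phi y = 0) s X) => //.
  - by move=> u v u0 v0; rewrite phiD u0 v0 addr0.
  - by move=> a u u0; rewrite phiZ u0 scaler0.
  - by move=> i u u0; rewrite phi_lie u0 lie0r.
move=> x y xy; apply/eqP; rewrite -subr_eq0; apply/eqP/ker.
by rewrite phiD phiN xy subrr.
Qed.

End Injectivity.

(** * Subsystems of real roots *)

Section SubRootSystem.
Variables (K : numFieldType) (n : nat) (A : 'M[int]_n).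
Hypothesis symA : forall i j, A i j = A j i.
Hypothesis diagA : forall i, A i i = 2.
Hypothesis detA : \det A != 0.

Local Notation g := (kac_moody K A).
Local Notation e := (km_e K A).
Local Notation f := (km_f K A).
Local Notation h := (km_h K A).
Local Notation al := (@alpha n).
Local Notation bil := (bil A).
Local Notation wt := (@wt K n A).
Local Notation nu := (@nu K n A).
Implicit Types (b : 'rV[int]_n) (i j : 'I_n) (w : seq 'I_n) (x y z : g).

Lemma wt_iter_lie b c x y k : wt b x -> wt c y ->
  wt (b *+ k + c) (iter k (lie x) y).
Proof.
move=> wx wy; elim: k => [|k IH]; first by rewrite mulr0n add0r.
by rewrite mulrS -addrA; exact: wt_lie.
Qed.

(** With $k=1-(b,c)\geq 1$ the weight $kb+c$ has norm $2k^2+2k(1-k)+2=2k+2>2$. *)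
Lemma wt_serre b c x y : wt b x -> wt c y -> bil b b = 2 -> bil c c = 2 ->
  bil b c <= 0 -> iter `|1 - bil b c|%N (lie x) y = 0.
Proof.
move=> wx wy bb cc bc; set k := `|_|%N.
have kE : k%:Z = 1 - bil b c by rewrite /k; lia.
apply: (wt_norm symA diagA detA (wt_iter_lie k wx wy)).
rewrite !bilDl !bilDr !bilMnl !bilMnr bb cc (bilC symA c b) !pmulrn !mulrzz kE.
by nia.
Qed.

(** The weight $b+c$ has norm at least 4. *)
Lemma wt_lie_orth b c x y : wt b x -> wt c y -> bil b b = 2 -> bil c c = 2 ->
  0 <= bil b c -> lie x y = 0.
Proof.
move=> wx wy bb cc bc; apply: (wt_norm symA diagA detA (wt_lie wx wy)).
by rewrite !bilDl !bilDr bb cc (bilC symA c b); lia.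
Qed.

End SubRootSystem.

(** * Real Kac-Moody subalgebras from root vectors of norm 2 *)

Section RealSubalgebra.
Variables (R : rcfType) (n m : nat) (A : 'M[int]_n) (B : 'M[int]_m).
Hypothesis symA : forall i j, A i j = A j i.
Hypothesis diagA : forall i, A i i = 2.
Hypothesis detA : \det A != 0.
Hypothesis diagB : forall i, B i i = 2.
Hypothesis offB : forall i j, i != j -> B i j <= 0.
Local Notation g := (kac_moody R[i] A).
Local Notation wt := (@wt R[i] n A).
Variables (gam : 'I_m -> 'rV[int]_n) (E F : 'I_m -> g).
Hypothesis gamB : forall i j, bil A (gam i) (gam j) = B i j.
Hypothesis wtE : forall i, wt (gam i) (E i).
Hypothesis wtF : forall i, wt (- gam i) (F i).
Hypothesis EF : forall i, lie (E i) (F i) = nu R[i] A (gam i).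

Definition subsystem_gen (k : chevalley m) : realification g :=
  match k with CE i => E i | CF i => F i | CH i => nu R[i] A (gam i) end.

Let real_scaleE (a : int) (x : realification g) : (a%:~R : R) *: x = (a%:~R :
  R[i]) *: (x : g).
Proof. by rewrite -[LHS]/(real_scale _ _) /real_scale rmorph_int. Qed.

Lemma real_lieE (x y : realification g) : lie x y = lie (x : g) (y : g).
Proof. by []. Qed.

Lemma subsystem_rel u : chevalley_serre B u -> lie_eval subsystem_gen u = 0.
Proof.
case=> [i j|i j|i j|i|i j ij|i j ij|i j ij] /=.
- by rewrite real_lieE (lie_nu symA _ (wt_nu _ _ _)) bil0r scale0r.
- rewrite real_lieE (lie_nu symA _ (wtE j)) gamB scaleN1r real_scaleE;
    exact: subrr.
- rewrite real_lieE (lie_nu symA _ (wtF j)) bilNr gamB scaleN1r -intrN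
    real_scaleE.
  exact: subrr.
- rewrite real_lieE EF scaleN1r; exact: subrr.
- apply: (wt_lie_orth symA diagA detA (wtE i) (wtF j)).
  + by rewrite gamB.
  + by rewrite bilNl bilNr opprK gamB.
  + by rewrite bilNr gamB oppr_ge0 offB.
- rewrite lie_eval_iter /= -gamB.
  by apply: (wt_serre symA diagA detA (wtE i) (wtE j));
    rewrite gamB ?diagB ?offB.
- rewrite lie_eval_iter /= -gamB -[bil A _ _]opprK -bilNl -bilNr.
  apply: (wt_serre symA diagA detA (wtF i) (wtF j)).
  all: by rewrite bilNl bilNr opprK gamB ?diagB ?offB.
Qed.

Definition subsystem_morphism : kac_moody R B -> realification g :=
  pres_lift subsystem_gen.

Lemma subsystem_morphismP : lie_morphism subsystem_morphism.
Proof. exact: (pres_lift_morphism subsystem_rel). Qed.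

Lemma subsystem_e i : subsystem_morphism (km_e R B i) = E i.
Proof. exact: (pres_liftE subsystem_rel). Qed.

Lemma subsystem_f i : subsystem_morphism (km_f R B i) = F i.
Proof. exact: (pres_liftE subsystem_rel). Qed.

Lemma subsystem_injective : \det B != 0 -> (forall i, E i != 0) ->
  injective subsystem_morphism.
Proof.
move=> detB E0; apply: (kac_moody_morphism_injective _ diagB detB
  subsystem_morphismP).
- by move=> i j; rewrite -!gamB; exact: bilC.
- by move=> i; rewrite subsystem_e; exact: E0.
Qed.

End RealSubalgebra.

(** * DE10 in the commutant of so(16) *)

Section CartanComputation.
Variables (n : nat) (E : seq (int * int)).
Local Notation A := (cartan_of_edges n E).

(** A version on natural numbers: together with list coordinates and [sum_upto], it turns statements
    about the form into checks by evaluation. *)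
Definition cartan_entry (i j : nat) : int :=
  if i == j then 2
  else if ((i%:Z - 1, j%:Z - 1) \in E) || ((j%:Z - 1, i%:Z - 1) \in E) then -1
  else 0.

Lemma cartan_entryE (i j : 'I_n) : A i j = cartan_entry i j.
Proof. by rewrite mxE. Qed.

Lemma cartan_of_edges_sym (i j : 'I_n) : A i j = A j i.
Proof. by rewrite !mxE eq_sym orbC. Qed.

Lemma cartan_of_edges_diag (i : 'I_n) : A i i = 2.
Proof. by rewrite mxE eqxx. Qed.

Lemma cartan_of_edges_off (i j : 'I_n) : i != j -> A i j <= 0.
Proof. by move=> /negPf ij; rewrite mxE ij; case: ifP. Qed.

Definition root_of_seq (s : seq int) : 'rV[int]_n := \row_i s`_i.

Definition sum_upto (F : nat -> int) : int :=
  foldr +%R 0 [seq F i | i <- iota 0 n].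

Lemma sum_uptoE (F : nat -> int) : \sum_(i < n) F i = sum_upto F.
Proof. by rewrite /sum_upto foldrE big_map -(big_mkord xpredT F) /index_iota
  subn0. Qed.

Definition bil_seq (s t : seq int) : int :=
  sum_upto (fun j => sum_upto (fun i => s`_i * cartan_entry i j) * t`_j).

Lemma bil_seqE s t : bil A (root_of_seq s) (root_of_seq t) = bil_seq s t.
Proof.
rewrite /bil mxE /bil_seq -sum_uptoE; apply: eq_bigr => j _.
rewrite -sum_uptoE !mxE; congr (_ * _).
by apply: eq_bigr => i _; rewrite !mxE.
Qed.

Lemma alpha_seqE (i : 'I_n) : alpha i = root_of_seq (nseq i 0 ++ [:: 1]).
Proof.
apply/rowP => j; rewrite !mxE eqxx /= nth_cat size_nseq nth_nseq.
case: (ltngtP j i) => [ji|ij|/val_inj ->].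
- by rewrite -val_eqE ltn_eqF.
- by rewrite -val_eqE gtn_eqF //= nth_default //= subn_gt0.
- by rewrite eqxx subnn.
Qed.

(** A certificate for an invertible matrix: T is d times the inverse, with d clearing denominators.
    Checking a product avoids expanding a determinant of size 18; both diagrams use d = 2. *)
Definition is_inverse (d : int) (T : seq (seq int)) : bool :=
  all (fun i => all (fun j =>
    sum_upto (fun k => cartan_entry i k * (nth [::] T k)`_j) == d * (i == j)%:R)
    (iota 0 n)) (iota 0 n).

Lemma det_cartan_neq0 d T : d != 0 -> is_inverse d T -> \det A != 0.
Proof.
move=> d0 /allP inv; pose B : 'M[int]_n := \matrix_(i, j) (nth [::] T i)`_j.
have AB : A *m B = d%:M.
  apply/matrixP => i j; rewrite !mxE.
  have iP (k : 'I_n) : val k \in iota 0 n by rewrite mem_iota ltn_ord.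
  have /allP /(_ _ (iP j)) /eqP := inv _ (iP i).
  rewrite -sum_uptoE mulr_natr -val_eqE => <-.
  by apply: eq_bigr => k _; rewrite !mxE.
apply: contra_neq d0 => detA; have := congr1 determinant AB.
by rewrite det_mulmx detA mul0r det_scalar => /esym/eqP;
  rewrite expf_eq0 => /andP [_ /eqP].
Qed.

End CartanComputation.

Lemma det_cartan_DE10 : \det cartan_DE10 != 0.
Proof.
apply: (@det_cartan_neq0 _ _ 2 [::
  [:: 0; -2; -4; -4; -4; -4; -4; -2; -2; -2];
  [:: -2; -4; -8; -8; -8; -8; -8; -4; -4; -4];
  [:: -4; -8; -12; -12; -12; -12; -12; -6; -6; -6];
  [:: -4; -8; -12; -10; -10; -10; -10; -5; -6; -5];
  [:: -4; -8; -12; -10; -8; -8; -8; -4; -6; -4];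
  [:: -4; -8; -12; -10; -8; -6; -6; -3; -6; -3];
  [:: -4; -8; -12; -10; -8; -6; -4; -2; -6; -2];
  [:: -2; -4; -6; -5; -4; -3; -2; 0; -3; -1];
  [:: -2; -4; -6; -6; -6; -6; -6; -3; -2; -3];
  [:: -2; -4; -6; -5; -4; -3; -2; -1; -3; 0]]); last by vm_compute.
by [].
Qed.

Lemma det_cartan_DE18 : \det cartan_DE18 != 0.
Proof.
apply: (@det_cartan_neq0 _ _ 2 [::
  [:: 0; -2; -4; -4; -4; -4; -4; -4; -4; -2; -4; -4; -4; -4; -4; -4; -2; -2];
  [:: -2; -4; -8; -8; -8; -8; -8; -8; -8; -4; -8; -8; -8; -8; -8; -8; -4; -4];
  [:: -4; -8; -12; -12; -12; -12; -12; -12; -12; -6; -12; -12; -12; -12; -12;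
    -12; -6; -6];
  [:: -4; -8; -12; -10; -10; -10; -10; -10; -10; -6; -10; -10; -10; -10; -10;
    -10; -5; -5];
  [:: -4; -8; -12; -10; -8; -8; -8; -8; -8; -6; -8; -8; -8; -8; -8; -8; -4; -4];
  [:: -4; -8; -12; -10; -8; -6; -6; -6; -6; -6; -6; -6; -6; -6; -6; -6; -3; -3];
  [:: -4; -8; -12; -10; -8; -6; -4; -4; -4; -6; -4; -4; -4; -4; -4; -4; -2; -2];
  [:: -4; -8; -12; -10; -8; -6; -4; -2; -2; -6; -2; -2; -2; -2; -2; -2; -1; -1];
  [:: -4; -8; -12; -10; -8; -6; -4; -2; 0; -6; 0; 0; 0; 0; 0; 0; 0; 0];
  [:: -2; -4; -6; -6; -6; -6; -6; -6; -6; -2; -6; -6; -6; -6; -6; -6; -3; -3];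
  [:: -4; -8; -12; -10; -8; -6; -4; -2; 0; -6; 2; 2; 2; 2; 2; 2; 1; 1];
  [:: -4; -8; -12; -10; -8; -6; -4; -2; 0; -6; 2; 4; 4; 4; 4; 4; 2; 2];
  [:: -4; -8; -12; -10; -8; -6; -4; -2; 0; -6; 2; 4; 6; 6; 6; 6; 3; 3];
  [:: -4; -8; -12; -10; -8; -6; -4; -2; 0; -6; 2; 4; 6; 8; 8; 8; 4; 4];
  [:: -4; -8; -12; -10; -8; -6; -4; -2; 0; -6; 2; 4; 6; 8; 10; 10; 5; 5];
  [:: -4; -8; -12; -10; -8; -6; -4; -2; 0; -6; 2; 4; 6; 8; 10; 12; 6; 6];
  [:: -2; -4; -6; -5; -4; -3; -2; -1; 0; -3; 1; 2; 3; 4; 5; 6; 4; 3];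
  [:: -2; -4; -6; -5; -4; -3; -2; -1; 0; -3; 1; 2; 3; 4; 5; 6; 3; 4]]);
    last by vm_compute.
by [].
Qed.

Section Connectivity.
Variables (K : numFieldType) (n : nat) (E : seq (int * int)).
Local Notation A := (cartan_of_edges n E).
Local Notation e := (km_e K A).

Fixpoint connected_from (s t : seq nat) : bool :=
  if t is k :: t' then
    has (fun l => (l < n)%N && (cartan_entry E k l != 0)) s && connected_from
      (k :: s) t'
  else true.

(** If $e_j=0$ then $h_j=[e_j,f_j]=0$, and $[h_j,e_l]=A_{jl}e_l$ gives $e_l=0$ for each neighbour l.
    So nonvanishing spreads along edges. *)
Lemma km_e_neq0 (s t : seq nat) : connected_from s t ->
  (forall i : 'I_n, val i \in s -> e i != 0) ->
  forall i : 'I_n, val i \in s ++ t -> e i != 0.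
Proof.
elim: t s => [|k t IH] s /=; first by rewrite cats0.
move=> /andP [/hasP [l ls /andP [ln kl]] skt] es i.
rewrite mem_cat inE orbCA -mem_cat => it; apply: (IH (k :: s)) => //=.
move=> j; rewrite inE => /predU1P [jk|]; last exact: es.
have el := es (Ordinal ln) ls; apply: contra_neq el => ej0.
have := km_he K A j (Ordinal ln); rewrite -km_ef ej0 !lie0l cartan_entryE jk.
by move=> /esym/eqP; rewrite scaler_eq0 intr_eq0 (negPf kl) => /eqP.
Qed.

End Connectivity.

Section OmegaWeights.
Variable K : numFieldType.

Lemma weight_eval_map n (A : 'M[int]_n) (b : 'rV[int]_n) i :
  (forall i j, A i j = A j i) ->
  weight_eval A (map_mx intr b : 'rV[K]_n) i = (bil A b (alpha i))%:~R.
Proof.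
move=> symA; rewrite bil_alphar mxE rmorph_sum; apply: eq_bigr => j _.
by rewrite mxE -intrM symA.
Qed.

Lemma sum_simple_root n (P : pred 'I_n) j :
  (\sum_(k | P k) simple_root K k) 0 j = (P j)%:R.
Proof.
rewrite summxE; case: (boolP (P j)) => Pj; last first.
  rewrite big1 // => k Pk; rewrite mxE; case: (eqVneq j k) => [jk|_].
    by rewrite jk Pk in Pj.
  by rewrite andbF.
rewrite (bigD1 j) //= mxE !eqxx big1 ?addr0 // => k /andP [_ /negPf kj].
by rewrite mxE eq_sym kj andbF.
Qed.

End OmegaWeights.

(** * The root vectors fixed by omega and the embedding of DE10 *)

Section Omega.
Variable R : realType.
Variable omega : DE18 R[i] -> DE18 R[i].
Hypothesis homega : is_omega omega.
Local Notation C := R[i].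
Local Notation A := cartan_DE18.
Local Notation e := (km_e C A).
Local Notation f := (km_f C A).
Local Notation h := (km_h C A).
Local Notation wt := (@wt C 18 A).
Local Notation bil := (bil A).
Local Notation rt := (root_of_seq 18).

Let symA : forall i j, A i j = A j i := @cartan_of_edges_sym 18 edges_DE18.
Let diagA : forall i, A i i = 2 := @cartan_of_edges_diag 18 edges_DE18.
Let detA := det_cartan_DE18.

(** The coordinates of $\omega^*\beta_7$. Position k belongs to node k - 1: the entry 1 at position
    8 is $\beta_7$ and the 0 after it is $\beta_8$. *)
Definition kappa_seq : seq int :=
  [:: 0; 0; 0; 0; 0; 0; 0; 0; 1; 0; 2; 2; 2; 2; 2; 2; 1; 1].
Local Notation kappa := (rt kappa_seq).

Lemma omega_star_node7 :
  omega_star (simple_root C node7) = map_mx intr kappa.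
Proof.
have n7 : node node7 = 7 by rewrite /node inordK.
rewrite /omega_star (bigD1 node7) //= big1 => [|i /negPf i7]; last first.
  by rewrite mxE i7 andbF scale0r.
rewrite mxE !eqxx scale1r addr0 /omega_star_simple /split_node /compact_node n7
  /=.
apply/rowP => j; rewrite !(mxE, sum_simple_root) eqxx /=.
have /allP /(_ (val j)) : all (fun k : nat => (k == 8)%:R
    + 2 * (9 <= k%:Z - 1 <= 14)%R%:R + (k%:Z - 1 == 15)%R%:R + (k%:Z - 1 ==
        16)%R%:R
    == kappa_seq`_k) (iota 0 18) by vm_compute.
rewrite mem_iota ltn_ord => /(_ isT) /eqP <-.
by rewrite !intrD intrM !mulrz_nat -val_eqE /= inordK.
Qed.

Lemma wt_omega_e7 : wt kappa (omega (e node7)).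
Proof.
by move=> i; rewrite (omega_e7_root homega i) omega_star_node7 weight_eval_map.
Qed.

Lemma wt_omega_f7 : wt (- kappa) (omega (f node7)).
Proof.
move=> i; rewrite (omega_f7_root homega i) omega_star_node7.
have -> : - map_mx intr kappa = map_mx intr (- kappa) :> 'rV[C]_18.
  by apply/rowP => j; rewrite !mxE intrN.
by rewrite weight_eval_map.
Qed.

Lemma omega0 : omega 0 = 0.
Proof.
by have := omegaD homega 0 0; rewrite addr0 => /eqP;
  rewrite -subr_eq0 opprD addrA subrr sub0r oppr_eq0 => /eqP.
Qed.

Lemma omegaN x : omega (- x) = - omega x.
Proof.
by apply/eqP; rewrite -addr_eq0 -(omegaD homega) addNr omega0.
Qed.

Lemma DE18_e_neq0 i : e i != 0.
Proof.
(* Node 7, of index 8, is the start, since [omega (e node7)] is nonzero. The walk goes down the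
   chain to node -1, then through nodes 8 to 16, each joined to one already reached. *)
apply: (@km_e_neq0 C 18 edges_DE18 [:: 8]%N (rev (iota 0 8) ++ iota 9 9));
  last 1 first.
- rewrite !(mem_cat, inE, mem_rev, mem_iota); have := ltn_ord i.
  by rewrite -[nat_of_ord i]/(val i); move: (val i) => k; lia.
- by vm_compute.
move=> j; rewrite inE => /eqP j8; have -> : j = node7 by apply: val_inj;
  rewrite j8 /= inordK.
by apply: contra_notN (omega_e7_neq0 homega) => /eqP ->; exact: omega0.
Qed.

Definition node6 : 'I_18 := inord 7.
Local Notation a6 := (alpha node6).
Local Notation a7 := (alpha node7).
Local Notation x7 := (omega (e node7)).
Local Notation y7 := (omega (f node7)).

Lemma alpha6 : a6 = rt (nseq 7 0 ++ [:: 1]).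
Proof. by rewrite alpha_seqE inordK. Qed.

Lemma alpha7 : a7 = rt (nseq 8 0 ++ [:: 1]).
Proof. by rewrite alpha_seqE inordK. Qed.

Lemma bil_kappa_kappa : bil kappa kappa = 2.
Proof. by rewrite bil_seqE; vm_compute. Qed.
Lemma bil_kappa6 : bil kappa a6 = -1.
Proof. by rewrite alpha6 bil_seqE; vm_compute. Qed.
Lemma bil_kappa7 : bil kappa a7 = 0.
Proof. by rewrite alpha7 bil_seqE; vm_compute. Qed.
Lemma bil67 : bil a6 a7 = -1.
Proof. by rewrite alpha6 alpha7 bil_seqE; vm_compute. Qed.

Lemma node6_split : split_node node6.
Proof. by rewrite /split_node /node inordK. Qed.

Lemma node67 : node6 != node7.
Proof. by rewrite -val_eqE /= !inordK. Qed.

Lemma omega_e6 : omega (e node6) = e node6.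
Proof. exact: (omega_e_split homega node6_split). Qed.
Lemma omega_f6 : omega (f node6) = f node6.
Proof. exact: (omega_f_split homega node6_split). Qed.

(* [omega h_7] lies on the line of [nu kappa]; its bracket with [e_6] fixes the
   factor. *)
Lemma lie_omega_ef7 : lie x7 y7 = nu C A kappa.
Proof.
have [w kw] : exists w, kappa = content w.
  have x0 : x7 != 0 by apply/eqP; exact: (omega_e7_neq0 homega).
  case: (wt_sign symA detA wt_omega_e7 x0) => // -[w kw].
  have := congr1 (fun b : 'rV_18 => b 0 node7) kw.
  by rewrite [LHS]mxE [RHS]mxE contentE inordK //=; lia.
have w0 : w != [::].
  by apply: contra_eqN bil_kappa_kappa => /eqP w0;
    rewrite kw w0 /content big_nil bil0l.
have := line_content symA detA DE18_e_neq0 w0; rewrite -kw.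
move=> /(_ _ _ wt_omega_e7 wt_omega_f7) [c xyc].
have := omega_lie homega (h node7) (e node6).
rewrite -(omega_h7 homega) km_he omega_e6 symA -bil_alpha bil67 scaleN1r omegaN
  omega_e6.
rewrite xyc lieZl (lie_nu symA _ (wt_e C symA _)) bil_kappa6 scaleN1r scalerN
  => /oppr_inj /eqP.
rewrite -subr_eq0 -{1}[e node6]scale1r -scalerBl scaler_eq0 (negPf (DE18_e_neq0
  _)) orbF.
by rewrite subr_eq0 => /eqP <-; rewrite scale1r.
Qed.

Definition root_e : DE18 C := lie (lie (e node6) (e node7)) x7.
Definition root_f : DE18 C := lie (lie (f node6) (f node7)) y7.
Local Notation delta := (a6 + a7 + kappa).

Lemma wt_e67 : wt (a6 + a7) (lie (e node6) (e node7)).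
Proof. exact: wt_lie (wt_e C symA _) (wt_e C symA _). Qed.
Lemma wt_f67 : wt (- (a6 + a7)) (lie (f node6) (f node7)).
Proof. by rewrite opprD; exact: wt_lie (wt_f C symA _) (wt_f C symA _). Qed.
Lemma wt_root_e : wt delta root_e.
Proof. exact: wt_lie wt_e67 wt_omega_e7. Qed.
Lemma wt_root_f : wt (- delta) root_f.
Proof. by rewrite opprD; exact: wt_lie wt_f67 wt_omega_f7. Qed.

(** The minus sign comes from writing both brackets in the same order. It disappears in
    [lie_root_ef], where $(\alpha_6+\alpha_7,\kappa)=-1$ contributes a second sign. *)
Lemma lie_e67_f67 :
  lie (lie (e node6) (e node7)) (lie (f node6) (f node7)) = - nu C A (a6 + a7).
Proof.
rewrite lie_derl (lie_derr (e node7) (f node6)) km_ef (km_ef0 _ _ (i :=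
  node7)); last first.
  by rewrite eq_sym node67.
rewrite lie0l add0r (lie_derr (e node6) (f node6) (f node7)) km_ef (km_ef0 _ _
  node67) lie0r addr0.
have A67 : (A node6 node7)%:~R = -1 :> C by rewrite -bil_alpha bil67.
rewrite (lieC (h node7)) !km_hf (symA node7) !A67 opprK !scale1r.
by rewrite lieNr !km_ef nuD !nu_alpha opprD.
Qed.

Let norm0 (b : 'rV[int]_18) (z : kac_moody C A) : wt b z -> 2 < bil b b ->
  z = 0 :=
  @wt_norm C 18 A symA diagA detA b z.

Let bil_simp := (bilDl, bilDr, bilNl, bilNr, bil_kappa_kappa, bil_kappa6,
  bil_kappa7,
  bilC symA a6 kappa, bilC symA a7 kappa, bilC symA a7 a6, bil67,
  bil_alpha A node6 node6, bil_alpha A node7 node7, diagA).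

Lemma lie_root_ef : lie root_e root_f = nu C A delta.
Proof.
set u := lie (e node6) (e node7); set v := lie (f node6) (f node7).
(* The weight $\alpha_6+\alpha_7-\kappa$ has norm $2+2+2=6$. *)
have uy : lie u y7 = 0.
  by apply: norm0 (wt_lie wt_e67 wt_omega_f7) _; rewrite !bil_simp.
have xv : lie x7 v = 0.
  by apply: norm0 (wt_lie wt_omega_e7 wt_f67) _; rewrite !bil_simp.
rewrite /root_e /root_f -/u -/v lie_derl (lie_derr x7 v) xv lie0l add0r
  lie_omega_ef7.
rewrite (lie_derr u v y7) uy lie0r addr0 lie_e67_f67 (lieC (nu _ _ _)).
rewrite (lie_nu symA _ wt_f67) lieNl (lie_nu symA _ wt_omega_f7) !bil_simp.
rewrite addr0 opprK !scale1r !lieNr lie_e67_f67 lie_omega_ef7 !opprK.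
by rewrite [nu C A delta]nuD.
Qed.

Lemma omega_root_e : omega root_e = root_e.
Proof.
rewrite /root_e !(omega_lie homega) (omegaK homega) omega_e6.
have xe : lie x7 (e node7) = 0.
  by apply: norm0 (wt_lie wt_omega_e7 (wt_e C symA _)) _; rewrite !bil_simp.
by rewrite lie_derl xe lie0r sub0r -lieC.
Qed.

Lemma omega_root_f : omega root_f = root_f.
Proof.
rewrite /root_f !(omega_lie homega) (omegaK homega) omega_f6.
have xe : lie y7 (f node7) = 0.
  by apply: norm0 (wt_lie wt_omega_f7 (wt_f C symA _)) _; rewrite !bil_simp.
by rewrite lie_derl xe lie0r sub0r -lieC.
Qed.

(* The simple roots gamma_-1, ..., gamma_8 of DE10: the first eight are
   beta_-1, ..., beta_6, then come beta_8 and beta_6 + beta_7 + omega^*(beta_7). *)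
Definition gamma_index (k : nat) : nat := if k == 8 then 9 else k.
Definition gamma_seq (k : nat) : seq int :=
  if k == 9 then [:: 0; 0; 0; 0; 0; 0; 0; 1; 2; 0; 2; 2; 2; 2; 2; 2; 1; 1]
  else nseq (gamma_index k) 0 ++ [:: 1].
Definition gamma (i : 'I_10) : 'rV[int]_18 := rt (gamma_seq i).
Definition gamma_e (i : 'I_10) : kac_moody C A :=
  if val i == 9 then root_e else e (inord (gamma_index i)).
Definition gamma_f (i : 'I_10) : kac_moody C A :=
  if val i == 9 then root_f else f (inord (gamma_index i)).

Lemma gammaE (i : 'I_10) : gamma i = if val i == 9 then delta else alpha (inord
  (gamma_index i)).
Proof.
rewrite /gamma /gamma_seq; case: ifP => i9; last first.
  rewrite alpha_seqE inordK // /gamma_index; case: ifP => // _.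
  by rewrite (leq_trans (ltn_ord i)).
rewrite alpha6 alpha7; apply/rowP => j; rewrite !mxE.
have /allP /(_ (val j)) : all (fun k => [:: 0; 0; 0; 0; 0; 0; 0; 1; 2; 0; 2; 2;
  2; 2; 2; 2; 1; 1]`_k
   == (nseq 7 0 ++ [:: 1])`_k + (nseq 8 0 ++ [:: 1])`_k + kappa_seq`_k :> int)
     (iota 0 18) by vm_compute.
by rewrite mem_iota ltn_ord => /(_ isT) /eqP.
Qed.

Lemma bil_gamma i j : bil (gamma i) (gamma j) = cartan_DE10 i j.
Proof.
rewrite bil_seqE cartan_entryE.
have /allP /(_ (val i)) : all (fun k => all (fun l =>
    bil_seq 18 edges_DE18 (gamma_seq k) (gamma_seq l) == cartan_entry
      edges_DE10 k l)
    (iota 0 10)) (iota 0 10) by vm_compute.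
rewrite mem_iota ltn_ord => /(_ isT) /allP /(_ (val j)).
by rewrite mem_iota ltn_ord => /(_ isT) /eqP.
Qed.

(** Among the noncompact simple roots only $\beta_7$ meets the compact ones, and it enters through
    $\beta_7+\omega^*\beta_7$: since $\omega^*$ is an isometry equal to $-1$ on compact roots, the
    two products cancel. The proof is a finite check. *)
Lemma bil_gamma_compact i j : compact_node j -> bil (gamma i) (alpha j) = 0.
Proof.
move=> jc; rewrite alpha_seqE bil_seqE.
have /allP /(_ (val i)) : all (fun k => all (fun l =>
    bil_seq 18 edges_DE18 (gamma_seq k) (nseq l 0 ++ [:: 1]) == 0)
    (iota 10 8)) (iota 0 10) by vm_compute.
rewrite mem_iota ltn_ord => /(_ isT) /allP /(_ (val j)).
rewrite mem_iota => H; apply/eqP/H; have := ltn_ord j.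
by move: jc; rewrite /compact_node /node -[nat_of_ord j]/(val j);
  move: (val j) => k; lia.
Qed.

Lemma wt_gamma_e i : wt (gamma i) (gamma_e i).
Proof.
by rewrite gammaE /gamma_e; case: ifP => _; [exact: wt_root_e|exact: wt_e].
Qed.

Lemma wt_gamma_f i : wt (- gamma i) (gamma_f i).
Proof.
by rewrite gammaE /gamma_f; case: ifP => _; [exact: wt_root_f|exact: wt_f].
Qed.

Lemma lie_gamma_ef i : lie (gamma_e i) (gamma_f i) = nu C A (gamma i).
Proof.
rewrite gammaE /gamma_e /gamma_f; case: ifP => _; first exact: lie_root_ef.
by rewrite nu_alpha; exact: km_ef.
Qed.

Lemma gamma_e_neq0 i : gamma_e i != 0.
Proof.
apply/eqP => ei0; have := lie_gamma_ef i; rewrite ei0 lie0l => /esym.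
move=> /(nu_eq0 detA DE18_e_neq0) g0; have := bil_gamma i i.
by rewrite g0 bil0l mxE eqxx.
Qed.

Lemma gamma_index_split (i : 'I_10) : val i != 9 ->
  split_node (inord (gamma_index i)).
Proof.
move=> i9; have := ltn_ord i; rewrite -[nat_of_ord i]/(val i).
rewrite /split_node /node /gamma_index; case: eqVneq => [_ _|i8 il];
  first by rewrite inordK.
rewrite inordK; [move: (val i) i9 i8 il => k; lia|].
by move: (val i) il => k; lia.
Qed.

Lemma omega_gamma_e i : omega (gamma_e i) = gamma_e i.
Proof.
rewrite /gamma_e; case: ifPn => [_|i9]; first exact: omega_root_e.
exact/(omega_e_split homega)/gamma_index_split.
Qed.

Lemma omega_gamma_f i : omega (gamma_f i) = gamma_f i.
Proof.
rewrite /gamma_f; case: ifPn => [_|i9]; first exact: omega_root_f.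
exact/(omega_f_split homega)/gamma_index_split.
Qed.

(** The centralizer of z is a subalgebra, so generators suffice: $b\pm\alpha_j$ has norm 4, and
    [h j] acts on z by 0. *)
Lemma wt_commutes_D8 b z : bil b b = 2 -> (forall j,
  compact_node j -> bil b (alpha j) = 0) ->
  wt b z -> forall y, D8 y -> lie z y = 0.
Proof.
move=> bb bj wz y Dy; apply: (Dy (fun y' => lie z y' = 0)).
  split=> [|u v zu zv|a u zu|u v zu zv] /=; first exact: lie0r.
  - by rewrite lieDr zu zv addr0.
  - by rewrite lieZr zu scaler0.
  - by rewrite lie_derr zu zv lie0l lie0r addr0.
move=> _ [j jc [->|->|->]] /=.
- apply: (wt_lie_orth symA diagA detA wz (wt_e C symA j)) => //.
    by rewrite bil_alpha diagA.
  by rewrite bj.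
- apply: (wt_lie_orth symA diagA detA wz (wt_f C symA j)) => //.
    by rewrite bilNl bilNr opprK bil_alpha diagA.
  by rewrite bilNr bj.
- by rewrite lieC wz bj // scale0r oppr0.
Qed.

Lemma norm_gamma i : bil (gamma i) (gamma i) = 2.
Proof. by rewrite bil_gamma mxE eqxx. Qed.

Definition DE10_embedding : DE10 R -> realification (DE18 C) :=
  @subsystem_morphism R 18 10 A cartan_DE10 gamma gamma_e gamma_f.

Let diagB : forall i, cartan_DE10 i i = 2 :=
  @cartan_of_edges_diag 10 edges_DE10.
Let offB : forall i j, i != j -> cartan_DE10 i j <= 0 :=
  @cartan_of_edges_off 10 edges_DE10.

Lemma DE10_embedding_morphism : lie_morphism DE10_embedding.
Proof.
exact: (subsystem_morphismP symA diagA detA diagB offB bil_gamma wt_gamma_e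
  wt_gamma_f lie_gamma_ef).
Qed.

Lemma DE10_embedding_injective : injective DE10_embedding.
Proof.
exact: (subsystem_injective symA diagA detA diagB offB bil_gamma wt_gamma_e
  wt_gamma_f lie_gamma_ef det_cartan_DE10 gamma_e_neq0).
Qed.

Lemma DE10_embedding_e i : DE10_embedding (km_e R cartan_DE10 i) = gamma_e i.
Proof.
exact: (subsystem_e symA diagA detA diagB offB bil_gamma wt_gamma_e wt_gamma_f
  lie_gamma_ef).
Qed.

Lemma DE10_embedding_f i : DE10_embedding (km_f R cartan_DE10 i) = gamma_f i.
Proof.
exact: (subsystem_f symA diagA detA diagB offB bil_gamma wt_gamma_e wt_gamma_f
  lie_gamma_ef).
Qed.

(** Both conditions define real subalgebras, so generators suffice. Antilinearity of [omega] is
    compatible with them because the scalars of [DE10 R] are real, hence equal to their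
    conjugates. *)
Lemma DE10_embedding_commutes u : omega (DE10_embedding u) = DE10_embedding u /\
  forall y : DE18 C, D8 y -> lie (DE10_embedding u : DE18 C) y = 0.
Proof.
have [phiD phiZ phi_lie] := DE10_embedding_morphism.
apply: (@km_ind R 10 cartan_DE10 (fun u =>
  omega (DE10_embedding u) = DE10_embedding u
  /\ forall y : DE18 C, D8 y ->
    lie (DE10_embedding u : DE18 C) y = 0)) u => [|i|i].
- split=> [|u v [ou uD8] [ov vD8]|a u [ou uD8]|u v [ou uD8] [ov vD8]].
  + have -> : DE10_embedding 0 = 0 by rewrite -(scale0r 0) phiZ scale0r.
    by split=> [|y _]; [exact: omega0|exact: lie0l].
  + rewrite phiD; split=> [|y Dy]; first by rewrite (omegaD homega) ou ov.
    by rewrite lieDl uD8 // vD8 // addr0.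
  + rewrite phiZ -[a *: _]/(_ *: (DE10_embedding u : DE18 C)); split=> [|y Dy].
      by rewrite (omegaZ homega) ou conjc_real.
    by rewrite lieZl uD8 // scaler0.
  + rewrite phi_lie; split=> [|y Dy]; first by rewrite (omega_lie homega) ou ov.
    by rewrite real_lieE lie_derl (uD8 y Dy) (vD8 y Dy) !lie0r subrr.
- rewrite DE10_embedding_e; split; first exact: omega_gamma_e.
  apply: (wt_commutes_D8 (norm_gamma i) _ (wt_gamma_e i)) => j.
  exact: bil_gamma_compact.
- rewrite DE10_embedding_f; split; first exact: omega_gamma_f.
  apply: (wt_commutes_D8 _ _ (wt_gamma_f i)).
    by rewrite bilNl bilNr opprK norm_gamma.
  by move=> j jc; rewrite bilNl bil_gamma_compact // oppr0.
Qed.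

End Omega.

Theorem proposition5p1 (R : realType) (omega : DE18 R[i] -> DE18 R[i])
    (homega : is_omega omega) :
  exists S : set (realification (DE18 R[i])),
    [/\ lie_subalgebra S,
        (S `<=` g_com omega)%classic
      & lie_isomorphic_to_sub (DE10 R) S].
Proof.
have phiP := DE10_embedding_morphism homega; have [phiD phiZ phi_lie] := phiP.
exists (range (DE10_embedding omega)); split.
- split.
  + by exists 0; rewrite // -(scale0r 0) phiZ scale0r.
  + by move=> _ _ [u _ <-] [v _ <-]; exists (u + v).
  + by move=> a _ [u _ <-]; exists (a *: u).
  + by move=> _ _ [u _ <-] [v _ <-]; exists (lie u v).
- move=> _ [u _ <-]; have [ou uD8] := DE10_embedding_commutes homega u.
  by split=> // y [D8y _]; exact: uD8.
- by exists (DE10_embedding omega); split=> //; exact: DE10_embedding_injective.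
Qed.
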